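(* Let $\mathfrak X=(X,\xrightarrow{F},\le)$ be a functional WSTS whose underlying order $(X,\le)$ is $\omega^2$-wqo, and assume that its completion $\widehat{\mathfrak X}$ is $\infty$-effective, i.e., that $(\widehat g)^\infty$ is computable for every $g\in F^*$. Let $x_0\in X$. The following statements are equivalent: (1) $(\mathfrak X,x_0)$ is cover-flattable; (2) $(\mathfrak X,x_0)$ is weakly cover-flattable; (3) $(\mathfrak X,x_0)$ is strongly cover-flattable; (4) $(\widehat{\mathfrak X},\eta_X(x_0))$ is clover-flattable (equivalently, weakly clover-flattable; equivalently, strongly clover-flattable); (5) the procedure $\mathbf{Clover}_{\widehat{\mathfrak X}}$ terminates on input $\eta_X(x_0)$. In this case, $\mathbf{Clover}_{\widehat{\mathfrak X}}(\eta_X(x_0))$ returns $A=Clover_{\widehat{\mathfrak X}}(\eta_X(x_0))$, and $Cover_{\mathfrak X}(x_0)=\eta_X^{-1}(\downarrow A)$.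
   Context: Orders: $\downarrow E$, $\uparrow E$ are downward/upward closures, $\operatorname{Max}E$ maximal elements. A wpo is a partial order that is well-founded with no infinite antichain. Rado's structure is $X_{\mathrm{Rado}}=\{(m,n)\in\mathbb N^2\mid m<n\}$ with $(m,n)\le(m',n')$ iff ($m=m'$ and $n\le n'$) or $n<m'$. A wqo is $\omega^2$-wqo if it contains no subset which, with the induced order, is order-isomorphic to $X_{\mathrm{Rado}}$. A functional WSTS $(X,\xrightarrow{F},\le)$: $(X,\le)$ a wpo, $F$ a finite set of partial monotonic maps (domain upward-closed, monotone on the domain), $x\to x'$ iff $x'=f(x)$ for some $f\in F$. $Post$, $Post^*$: successors and reflexive-transitive closure; $Cover(x)=\downarrow Post^*(\downarrow x)$. $F^*$: finite compositions of elements of $F$ (word $g_1g_2$ denotes $g_2\circ g_1$). Completion: an ideal of $X$ is a nonempty downward-closed directed subset; $\widehat X=\mathrm{Idl}(X)$ ordered by inclusion (a continuous dcpo, lubs of directed families being unions); $\eta_X(x)=\downarrow x$. For a partial monotonic $f$, $\widehat f$ has domain $\{C\in\widehat X\mid C\cap\operatorname{dom}f\ne\emptyset\}$ and $\widehat f(C)=\downarrow f\langle C\cap\operatorname{dom}f\rangle$. The completion is $\widehat{\mathfrak X}=(\widehat X,\xrightarrow{\{\widehat f\mid f\in F\}},\subseteq)$. Dcpo notions: directed sets, $\operatorname{Lub}(E)=\{\bigvee D\mid D\subseteq E\text{ directed}\}$, continuity, Scott-open sets (upward-closed, inaccessible by directed lubs), Scott closure $cl$, partial continuous maps (Scott-open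 domain, preserving directed lubs within the domain). A complete transition system: functional transition system on a continuous dcpo that is a wpo, with partial continuous maps. $Clover(s)=\operatorname{Max}\operatorname{Lub}(Cover(s))$. Lub-acceleration of partial continuous $g$: $\operatorname{dom}g^\infty=\operatorname{dom}g$, $g^\infty(x)=\bigvee_n g^n(x)$ if $x<g(x)$, else $g(x)$. $\infty$-effective: states finitely coded, order decidable, each map computable with decidable domain, and each $g^\infty$ ($g\in F^*$) computable. Procedure $\mathbf{Clover}_{\mathfrak S}(s_0)$: $A\leftarrow\{s_0\}$; while $Post(A)\not\le^\flat A$ ($B\le^\flat C$ iff $\downarrow B\subseteq\downarrow C$): choose fairly $(g,a)\in F^*\times A$ with $a\in\operatorname{dom}g$ and set $A\leftarrow A\cup\{g^\infty(a)\}$; return $\operatorname{Max}A$. Fair: in every infinite run, every pair $(g,a)$ with $a$ in the current $A$ and $a\in\operatorname{dom}g$ is eventually picked. Flat: finitely many words $w_1,\dots,w_k$ over the transition alphabet such that every fireable transition sequence (from the initial state considered) lies in $w_1^*\cdots w_k^*$. Morphism $\varphi$ of functional transition systems: maps states to states and transitions to transitions so that $s'=f_1(s)$ implies $\varphi(s)\in\operatorname{dom}\varphi(f_1)$ and $\varphi(s')=\varphi(f_1)(\varphi(s))$. Monotonic flattening of ordered $\mathfrak X$: $(\mathfrak X_1,\varphi)$ with $\mathfrak X_1$ a flat ordered functional transition system (partial order, finite set of partial monotonic maps) and $\varphi$ a morphism monotone on states. $(\mathfrak X,x_0)$ is cover-flattable iff there are a monotonic flattening $(\mathfrak X_1,\varphi)$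 and $x_1$ with $\varphi(x_1)=x_0$ and $Cover_{\mathfrak X}(x_0)=\downarrow\varphi\langle Cover_{\mathfrak X_1}(x_1)\rangle$; weakly cover-flattable if instead $\varphi(x_1)\le x_0$ and $Cover_{\mathfrak X}(x_0)\subseteq\downarrow\varphi\langle Cover_{\mathfrak X_1}(x_1)\rangle$. An rl-automaton is a DFA $(F,Q,\delta,q_0)$ with partial $\delta$, all states final, recognizing some $\operatorname{Pfx}(w_1^*\cdots w_k^* )$. Synchronized product $\mathfrak X\times\mathcal A$: states $X\times Q$, $(x,q)\le(x',q')$ iff $x\le x'$, $q=q'$, maps $f\bowtie\delta:(x,q)\mapsto(f(x),\delta(q,f))$; $\pi_1$ first projection. Strongly cover-flattable: there is an rl-automaton $\mathcal A$ with $Cover_{\mathfrak X}(x_0)=\pi_1\langle Cover_{\mathfrak X\times\mathcal A}(x_0,q_0)\rangle$. For a complete system $\mathfrak S$: clover-flattable iff there are a continuous flattening $(\mathfrak S_1,\varphi)$ ($\mathfrak S_1$ flat complete transition system, $\varphi$ Scott-continuous on states) and $s_1$ with $\varphi(s_1)=s_0$ and $cl(Cover_{\mathfrak S}(s_0))=cl(\varphi\langle cl(Cover_{\mathfrak S_1}(s_1))\rangle)$; weakly: $\varphi(s_1)\le s_0$ and $\subseteq$; strongly: there is an rl-automaton $\mathcal A$ with $cl(Cover_{\mathfrak S}(s_0))=cl(\pi_1\langle cl(Cover_{\mathfrak S\times\mathcal A}(s_0,q_0))\rangle)$. *)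

(* Defs.v *)
From Stdlib Require Import List Classical ClassicalEpsilon FinFun.
Import ListNotations.
Set Implicit Arguments.

Definition seteq {A : Type} (P Q : A -> Prop) : Prop := forall x, P x <-> Q x.
Definition subset {A : Type} (P Q : A -> Prop) : Prop := forall x, P x -> Q x.
Definition img {A B : Type} (phi : A -> B) (P : A -> Prop) : B -> Prop :=
  fun b => exists a, P a /\ phi a = b.

Section Orders.
Variable X : Type.
Variable le : X -> X -> Prop.

Definition partial_order : Prop :=
  (forall x, le x x) /\ (forall x y z, le x y -> le y z -> le x z) /\
  (forall x y, le x y -> le y x -> x = y).

Definition slt (x y : X) : Prop := le x y /\ x <> y.

Definition wpo : Prop :=
  partial_order /\ well_founded slt /\
  ~ (exists f : nat -> X, forall i j, i <> j -> ~ le (f i) (f j) /\ ~ le (f j) (f i)).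

(* Rado's structure on {(m,n) | m < n} *)
Definition rado_le (p q : nat * nat) : Prop :=
  (fst p = fst q /\ snd p <= snd q) \/ snd p < fst q.

Definition omega2_wqo : Prop :=
  wpo /\
  ~ (exists r : nat -> nat -> X,
        forall m n m' n', m < n -> m' < n' ->
          (le (r m n) (r m' n') <-> rado_le (m, n) (m', n'))).

Definition dc (A : X -> Prop) : X -> Prop := fun y => exists x, A x /\ le y x.
Definition uc (A : X -> Prop) : X -> Prop := fun y => exists x, A x /\ le x y.

Definition maxset (E : X -> Prop) : X -> Prop :=
  fun x => E x /\ forall y, E y -> le x y -> y = x.

Definition pdom (f : X -> option X) (x : X) : Prop := f x <> None.

Definition pmono (f : X -> option X) : Prop :=
  (forall x y, le x y -> pdom f x -> pdom f y) /\
  (forall x y x' y', le x y -> f x = Some x' -> f y = Some y' -> le x' y').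

Definition directed (D : X -> Prop) : Prop :=
  (exists d, D d) /\
  forall x y, D x -> D y -> exists z, D z /\ le x z /\ le y z.

Definition is_lub (D : X -> Prop) (l : X) : Prop :=
  (forall d, D d -> le d l) /\ (forall u, (forall d, D d -> le d u) -> le l u).

Definition dcpo : Prop :=
  partial_order /\ forall D, directed D -> exists l, is_lub D l.

Definition way_below (x y : X) : Prop :=
  forall D l, directed D -> is_lub D l -> le y l -> exists d, D d /\ le x d.

Definition continuous_dcpo : Prop :=
  dcpo /\ forall y, directed (fun x => way_below x y) /\ is_lub (fun x => way_below x y) y.

Definition scott_open (U : X -> Prop) : Prop :=
  (forall x y, U x -> le x y -> U y) /\
  (forall D l, directed D -> is_lub D l -> U l -> exists d, D d /\ U d).

Definition scott_closed (C : X -> Prop) : Prop :=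
  (forall x y, C x -> le y x -> C y) /\
  (forall D l, directed D -> (forall d, D d -> C d) -> is_lub D l -> C l).

Definition scl (A : X -> Prop) : X -> Prop :=
  fun x => forall C, scott_closed C -> subset A C -> C x.

Definition pcont (f : X -> option X) : Prop :=
  scott_open (pdom f) /\
  forall D l fl, directed D -> (forall d, D d -> pdom f d) -> is_lub D l ->
    f l = Some fl -> is_lub (fun y => exists d, D d /\ f d = Some y) fl.

Definition lubs (E : X -> Prop) : X -> Prop :=
  fun l => exists D, directed D /\ subset D E /\ is_lub D l.

Fixpoint iter_opt (g : X -> option X) (n : nat) (x : X) : option X :=
  match n with
  | O => Some x
  | Datatypes.S n' => match g x with Some y => iter_opt g n' y | None => None end
  end.

(* lub-acceleration: [is_accel g x y] iff x \in dom g and y = g^\infty(x) *)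
Definition is_accel (g : X -> option X) (x y : X) : Prop :=
  exists gx, g x = Some gx /\
    ((slt x gx /\ is_lub (fun z => exists n, iter_opt g n x = Some z) y) \/
     (~ slt x gx /\ y = gx)).

End Orders.

Section FTS.
Variables (St L : Type) (le : St -> St -> Prop) (tr : L -> St -> option St).

Fixpoint wrun (w : list L) (s : St) : option St :=
  match w with
  | [] => Some s
  | a :: w' => match tr a s with Some s' => wrun w' s' | None => None end
  end.

Definition post (A : St -> Prop) : St -> Prop :=
  fun t => exists a s, A s /\ tr a s = Some t.

Definition post_star (s t : St) : Prop := exists w, wrun w s = Some t.

Definition cover (s : St) : St -> Prop :=
  dc le (fun t => exists s', le s' s /\ post_star s' t).

Definition clover (s : St) : St -> Prop := maxset le (lubs le (cover s)).

Fixpoint in_starprod (ws : list (list L)) (w : list L) : Prop :=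
  match ws with
  | [] => w = []
  | u :: ws' => exists n w', w = concat (repeat u n) ++ w' /\ in_starprod ws' w'
  end.

Definition flat (s0 : St) : Prop :=
  exists ws : list (list L), forall w, wrun w s0 <> None -> in_starprod ws w.

Definition fwsts : Prop := wpo le /\ Finite L /\ forall a, pmono le (tr a).

Definition complete_ts : Prop :=
  Finite L /\ continuous_dcpo le /\ wpo le /\ forall a, pcont le (tr a).

Definition flat_le (A B : St -> Prop) : Prop := subset (dc le A) (dc le B).
Definition inlist (A : list St) : St -> Prop := fun s => In s A.

Definition loop_cond (A : list St) : Prop := ~ flat_le (post (inlist A)) (inlist A).

Definition clover_step (A : list St) (g : list L) (a : St) (A' : list St) : Prop :=
  loop_cond A /\ In a A /\ pdom (wrun g) a /\
  exists y, is_accel le (wrun g) a y /\ A' = A ++ [y].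

Definition fair_infinite_run (s0 : St) (As : nat -> list St) (ch : nat -> list L * St) : Prop :=
  As 0 = [s0] /\
  (forall n, clover_step (As n) (fst (ch n)) (snd (ch n)) (As (Datatypes.S n))) /\
  (forall n g a, In a (As n) -> pdom (wrun g) a -> exists m, n <= m /\ ch m = (g, a)).

Definition clover_terminates (s0 : St) : Prop :=
  ~ exists As ch, fair_infinite_run s0 As ch.

Definition clover_returns (s0 : St) (B : St -> Prop) : Prop :=
  exists (n : nat) (As : nat -> list St) (ch : nat -> list L * St),
    As 0 = [s0] /\
    (forall m, m < n -> clover_step (As m) (fst (ch m)) (snd (ch m)) (As (Datatypes.S m))) /\
    ~ loop_cond (As n) /\ seteq B (maxset le (inlist (As n))).

End FTS.

Definition morphism {S1 L1 S2 L2 : Type} (tr1 : L1 -> S1 -> option S1)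
  (tr2 : L2 -> S2 -> option S2) (phi : S1 -> S2) (psi : L1 -> L2) : Prop :=
  forall a s s', tr1 a s = Some s' -> tr2 (psi a) (phi s) = Some (phi s').

Definition monotone {S1 S2 : Type} (le1 : S1 -> S1 -> Prop) (le2 : S2 -> S2 -> Prop)
  (phi : S1 -> S2) : Prop := forall x y, le1 x y -> le2 (phi x) (phi y).

Definition scott_continuous {S1 S2 : Type} (le1 : S1 -> S1 -> Prop) (le2 : S2 -> S2 -> Prop)
  (phi : S1 -> S2) : Prop :=
  forall D l, directed le1 D -> is_lub le1 D l -> is_lub le2 (img phi D) (phi l).

Fixpoint drun {Q L : Type} (d : Q -> L -> option Q) (q : Q) (w : list L) : option Q :=
  match w with
  | [] => Some q
  | a :: w' => match d q a with Some q' => drun d q' w' | None => None end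
  end.

Definition pfx {L : Type} (P : list L -> Prop) : list L -> Prop :=
  fun u => exists v, P (u ++ v).

Definition rl_automaton {Q L : Type} (d : Q -> L -> option Q) (q0 : Q) : Prop :=
  Finite Q /\
  exists ws : list (list L), forall w, drun d q0 w <> None <-> pfx (in_starprod ws) w.

Definition prod_le {X Q : Type} (le : X -> X -> Prop) : X * Q -> X * Q -> Prop :=
  fun p p' => le (fst p) (fst p') /\ snd p = snd p'.

Definition prod_tr {X Q L : Type} (tr : L -> X -> option X) (d : Q -> L -> option Q)
  : L -> X * Q -> option (X * Q) :=
  fun a p => match tr a (fst p), d (snd p) a with
             | Some x, Some q => Some (x, q)
             | _, _ => None
             end.

Section Flattability.
Variables (X L : Type) (le : X -> X -> Prop) (tr : L -> X -> option X).

Definition cover_flattable (x0 : X) : Prop :=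
  exists (Y L1 : Type) (le1 : Y -> Y -> Prop) (tr1 : L1 -> Y -> option Y)
         (phi : Y -> X) (psi : L1 -> L) (x1 : Y),
    (Finite L1 /\ partial_order le1 /\ (forall a, pmono le1 (tr1 a)) /\ flat tr1 x1) /\
    morphism tr1 tr phi psi /\ monotone le1 le phi /\
    phi x1 = x0 /\
    seteq (cover le tr x0) (dc le (img phi (cover le1 tr1 x1))).

Definition weakly_cover_flattable (x0 : X) : Prop :=
  exists (Y L1 : Type) (le1 : Y -> Y -> Prop) (tr1 : L1 -> Y -> option Y)
         (phi : Y -> X) (psi : L1 -> L) (x1 : Y),
    (Finite L1 /\ partial_order le1 /\ (forall a, pmono le1 (tr1 a)) /\ flat tr1 x1) /\
    morphism tr1 tr phi psi /\ monotone le1 le phi /\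
    le (phi x1) x0 /\
    subset (cover le tr x0) (dc le (img phi (cover le1 tr1 x1))).

Definition strongly_cover_flattable (x0 : X) : Prop :=
  exists (Q : Type) (d : Q -> L -> option Q) (q0 : Q),
    rl_automaton d q0 /\
    seteq (cover le tr x0) (img fst (cover (prod_le le) (prod_tr tr d) (x0, q0))).

Definition clover_flattable (s0 : X) : Prop :=
  exists (Y L1 : Type) (le1 : Y -> Y -> Prop) (tr1 : L1 -> Y -> option Y)
         (phi : Y -> X) (psi : L1 -> L) (s1 : Y),
    (complete_ts le1 tr1 /\ flat tr1 s1) /\
    morphism tr1 tr phi psi /\ scott_continuous le1 le phi /\
    phi s1 = s0 /\
    seteq (scl le (cover le tr s0)) (scl le (img phi (scl le1 (cover le1 tr1 s1)))).

Definition weakly_clover_flattable (s0 : X) : Prop :=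
  exists (Y L1 : Type) (le1 : Y -> Y -> Prop) (tr1 : L1 -> Y -> option Y)
         (phi : Y -> X) (psi : L1 -> L) (s1 : Y),
    (complete_ts le1 tr1 /\ flat tr1 s1) /\
    morphism tr1 tr phi psi /\ scott_continuous le1 le phi /\
    le (phi s1) s0 /\
    subset (scl le (cover le tr s0)) (scl le (img phi (scl le1 (cover le1 tr1 s1)))).

Definition strongly_clover_flattable (s0 : X) : Prop :=
  exists (Q : Type) (d : Q -> L -> option Q) (q0 : Q),
    rl_automaton d q0 /\
    seteq (scl le (cover le tr s0))
          (scl le (img fst (scl (prod_le le) (cover (prod_le le) (prod_tr tr d) (s0, q0))))).

End Flattability.

Section Completion.
Variables (X : Type) (le : X -> X -> Prop).

Definition ideal (C : X -> Prop) : Prop :=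
  (exists x, C x) /\ (forall x y, C x -> le y x -> C y) /\
  (forall x y, C x -> C y -> exists z, C z /\ le x z /\ le y z).

Definition Idl : Type := { C : X -> Prop | ideal C }.

Definition idl_le (C D : Idl) : Prop := subset (proj1_sig C) (proj1_sig D).

Lemma down_ideal (Hpo : partial_order le) (x : X) : ideal (fun y => le y x).
Proof.
  destruct Hpo as [Hr [Ht _]].
  split; [exists x; apply Hr|split].
  - intros a b Ha Hb; eauto.
  - intros a b Ha Hb; exists x; repeat split; auto.
Qed.

Definition eta (Hpo : partial_order le) (x : X) : Idl :=
  exist _ (fun y => le y x) (down_ideal Hpo x).

Definition hat_set (f : X -> option X) (C : X -> Prop) : X -> Prop :=
  fun y => exists x fx, C x /\ f x = Some fx /\ le y fx.

Lemma hat_ideal (Hpo : partial_order le) (f : X -> option X) (Hf : pmono le f)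
  (C : Idl) : (exists x, proj1_sig C x /\ pdom f x) -> ideal (hat_set f (proj1_sig C)).
Proof.
  destruct Hpo as [Hr [Ht _]]. destruct Hf as [Hup Hmon].
  destruct C as [C HC]; simpl; destruct HC as [_ [_ Hdir]].
  intros [x [Cx Dx]]. unfold pdom in Dx.
  split; [|split].
  - destruct (f x) as [fx|] eqn:E; [|congruence].
    exists fx, x, fx; auto.
  - intros a b [u [fu [Cu [Eu Hau]]]] Hba. exists u, fu; eauto.
  - intros a b [u [fu [Cu [Eu Hau]]]] [v [fv [Cv [Ev Hbv]]]].
    destruct (Hdir u v Cu Cv) as [z [Cz [Huz Hvz]]].
    assert (Dz : pdom f z) by (apply (Hup u z Huz); unfold pdom; congruence).
    unfold pdom in Dz. destruct (f z) as [fz|] eqn:Ez; [|congruence].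
    exists fz. split; [exists z, fz; auto|].
    split; eapply Ht; eauto.
Qed.

Definition hat (Hpo : partial_order le) (f : X -> option X) (Hf : pmono le f)
  (C : Idl) : option Idl :=
  match excluded_middle_informative (exists x, proj1_sig C x /\ pdom f x) with
  | left H => Some (exist _ _ (hat_ideal Hpo Hf C H))
  | right _ => None
  end.

End Completion.
Arguments idl_le {X} le C D.

Definition hat_tr {X L : Type} {le : X -> X -> Prop} {tr : L -> X -> option X}
  (Hpo : partial_order le) (Hm : forall a, pmono le (tr a)) : L -> Idl le -> option (Idl le) :=
  fun a => hat Hpo (Hm a).

Lemma omega2_po {X : Type} {le : X -> X -> Prop} : omega2_wqo le -> partial_order le.
Proof. intro H0; exact (proj1 (proj1 H0)). Qed.

(* infinity-effectiveness (closest available rendering of computability) *)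
Record infty_effective {St L : Type} (le : St -> St -> Prop) (tr : L -> St -> option St)
  : Type := {
  eff_code : St -> nat;
  eff_code_inj : forall s t, eff_code s = eff_code t -> s = t;
  eff_le : nat -> nat -> bool;
  eff_le_ok : forall s t, eff_le (eff_code s) (eff_code t) = true <-> le s t;
  eff_dom : L -> nat -> bool;
  eff_dom_ok : forall a s, eff_dom a (eff_code s) = true <-> pdom (tr a) s;
  eff_tr : L -> nat -> nat;
  eff_tr_ok : forall a s t, tr a s = Some t -> eff_tr a (eff_code s) = eff_code t;
  eff_acc : list L -> nat -> nat;
  eff_acc_ok : forall g s t, is_accel le (wrun tr g) s t ->
                 eff_acc g (eff_code s) = eff_code t
}.

(* Main.v *)
(** Everything is equivalent to one condition: there are words w_1, ..., w_k such that each
    element of the cover of x0 lies below w(x0) for some w in w_1^* ... w_k^*.  The nonempty left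
    quotients of w_1^* ... w_k^* form an rl-automaton, whose product with the system (or with its
    completion) is the required flattening; conversely the image of a flattening only uses the
    images of its own words.  On the completion, Scott closures are controlled by the fact that
    the ideals contained in a fixed set R form a Scott-closed set, and are lubs of principal
    ideals of points of R.

    A terminated run of Clover has accelerated finitely many words, which witness the condition.
    Conversely, in a fair run, the iterates u^n(a) of any word at any collected state are bounded
    by finitely many collected states: since X omits Rado's structure, the ideals form a
    well partial order, so some iterate is below a later one, and one acceleration of a power of u
    bounds a whole residue class of exponents.  By induction on k, w_1^* ... w_k^* is bounded by
    finitely many collected ideals; an ideal inside their union is inside one of them, and
    the loop exits. *)
Require Import Defs.
From Stdlib Require Import List FinFun Arith Lia Sorted Cantor.
From Stdlib Require Import Classical ClassicalEpsilon FunctionalExtensionality.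
From Stdlib Require Import PropExtensionality ProofIrrelevance.
Import ListNotations.

(** * Choice principles drawn from indefinite description *)

Lemma functional_choice {A B : Type} (R : A -> B -> Prop) :
  (forall a, exists b, R a b) -> exists f, forall a, R a (f a).
Proof.
  intros H. exists (fun a => proj1_sig (constructive_indefinite_description _ (H a))).
  intros a. exact (proj2_sig (constructive_indefinite_description _ (H a))).
Qed.

(** [R] may depend on the stage, so that each stage of a run can be given its own task. The
    invariant [P] travels inside a sigma type, where ordinary choice yields a total step
    function. *)
Lemma dependent_choice {A : Type} (P : A -> Prop) (R : nat -> A -> A -> Prop) (a0 : A) :
  P a0 -> (forall n a, P a -> exists b, P b /\ R n a b) ->
  exists f : nat -> A, f 0 = a0 /\ forall n, P (f n) /\ R n (f n) (f (S n)).
Proof.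
  intros H0 Hstep.
  assert (Hs : forall p : nat * {a | P a},
             exists b : {a | P a}, R (fst p) (proj1_sig (snd p)) (proj1_sig b)).
  { intros [n [a Ha]]. destruct (Hstep n a Ha) as [b [Hb HR]]. now exists (exist _ b Hb). }
  apply functional_choice in Hs as [s Hs].
  set (f := fix f n := match n with 0 => exist P a0 H0 | S m => s (m, f m) end).
  exists (fun n => proj1_sig (f n)). split; [reflexivity|].
  intros n. split; [exact (proj2_sig (f n))|exact (Hs (n, f n))].
Qed.

(** * Ramsey's theorem *)

Definition unbounded (H : nat -> Prop) : Prop := forall n, exists m, n <= m /\ H m.

Definition increasing (h : nat -> nat) : Prop := forall i j, i < j -> h i < h j.

Lemma increasing_of_step (h : nat -> nat) : (forall n, h n < h (S n)) -> increasing h.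
Proof.
  intros H i j Hij. induction Hij as [|j Hij IH]; [apply H|]. specialize (H j). lia.
Qed.

Lemma unbounded_enum (H : nat -> Prop) :
  unbounded H -> exists h, increasing h /\ forall n, H (h n).
Proof.
  intros HU. destruct (HU 0) as [a [_ Ha]].
  destruct (dependent_choice H (fun _ x y => x < y) a Ha) as [h [_ Hh]].
  - intros _ x _. destruct (HU (S x)) as [y [Hy Hy']]. now exists y.
  - exists h. split; [|intros n; apply Hh].
    apply increasing_of_step. intros n; apply Hh.
Qed.

(** The [k]-element sets are encoded as strictly increasing lists, and a colour is a truth value:
    [b] is the common colour. *)
Definition homogeneous (k : nat) (c : list nat -> Prop) (b : Prop) (H : nat -> Prop) : Prop :=
  forall l, StronglySorted lt l -> Forall H l -> length l = k -> (c l <-> b).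

(** Induction on [k]: repeatedly pick a point [a n], then shrink the current set, by the case [k],
    until the colour of [a n :: l] no longer depends on [l]. What remains is to select infinitely
    many [a n] of equal colour. *)
Lemma ramsey_unbounded (k : nat) : forall (c : list nat -> Prop) (H : nat -> Prop),
  unbounded H -> exists H' b, unbounded H' /\ subset H' H /\ homogeneous k c b H'.
Proof.
  induction k as [|k IH]; intros c H HU.
  - exists H, (c nil). split; [exact HU|]. split; [intros x Hx; exact Hx|].
    intros [|x l] _ _ E; [tauto|discriminate].
  - set (P := fun s : (nat -> Prop) * nat * Prop => unbounded (fst (fst s))).
    set (R := fun (_ : nat) (s t : (nat -> Prop) * nat * Prop) =>
       let '(G, _, _) := s in let '(G', a, b) := t in
       G a /\ subset G' G /\ (forall x, G' x -> a < x) /\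
       homogeneous k (fun l => c (a :: l)) b G').
    (* A state holds the point and the colour chosen on entering it, so [0] and [True] in the
       initial state are dummies and [a n], [b n] are read from state [S n]. *)
    destruct (dependent_choice P R (H, 0, True) HU) as [f [Hf0 Hf]].
    { intros n0 [[G a0] b0] HG. unfold P in HG; simpl in HG.
      destruct (HG 0) as [a [_ Ga]].
      destruct (IH (fun l => c (a :: l)) (fun x => G x /\ a < x)) as [G' [b [HU' [HS Hh]]]].
      { intros n. destruct (HG (n + S a)) as [m [Hm Gm]]. exists m; repeat split; auto; lia. }
      exists (G', a, b). split; [exact HU'|]. split; [exact Ga|].
      split; [intros x Hx; apply (HS x Hx)|]. split; [intros x Hx; apply (HS x Hx)|exact Hh]. }
    set (G := fun n => fst (fst (f n))).
    set (a := fun n => snd (fst (f (S n)))).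
    set (b := fun n => snd (f (S n))).
    assert (HR : forall n, G n (a n) /\ subset (G (S n)) (G n) /\
              (forall x, G (S n) x -> a n < x) /\
              homogeneous k (fun l => c (a n :: l)) (b n) (G (S n))).
    { intros n. destruct (Hf n) as [_ HR]. unfold G, a, b.
      destruct (f n) as [[? ?] ?], (f (S n)) as [[? ?] ?]. exact HR. }
    assert (Hmono : forall n m, n <= m -> subset (G m) (G n)).
    { intros n m Hnm. induction Hnm as [|m Hnm IHm]; intros x Hx; auto.
      apply IHm. destruct (HR m) as [_ [HS _]]. now apply HS. }
    assert (Hinc : increasing a).
    { apply increasing_of_step. intros n.
      destruct (HR n) as [_ [_ [Hlt _]]]. exact (Hlt _ (proj1 (HR (S n)))). }
    (* The tail of a list starting at [a n] lies in [G (S n)], so its colour is [b n]; indices of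
       constant colour therefore give a homogeneous set. *)
    assert (Hhom : forall (b0 : Prop) (I : nat -> Prop), unbounded I ->
              (forall n, I n -> (b n <-> b0)) ->
              exists H' b, unbounded H' /\ subset H' H /\ homogeneous (S k) c b H').
    { intros b0 I HI Hb0. exists (fun x => exists n, I n /\ x = a n), b0. split; [|split].
      - intros n. destruct (HI n) as [m [Hm Im]]. exists (a m). split; [|eauto].
        clear - Hm Hinc. induction Hm as [|m Hm IHm].
        + clear - Hinc. induction n as [|n IHn]; [lia|]. specialize (Hinc n (S n)). lia.
        + specialize (Hinc m (S m)). lia.
      - intros x [n [_ ->]]. replace H with (G 0) by (unfold G; now rewrite Hf0).
        exact (Hmono 0 n (Nat.le_0_l n) _ (proj1 (HR n))).
      - intros [|x l] Hsort HI' Hlen; [discriminate|].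
        apply StronglySorted_inv in Hsort as [Hsort Hx].
        apply Forall_cons_iff in HI' as [[n [In ->]] HI'].
        rewrite <- (Hb0 n In). destruct (HR n) as [_ [_ [_ Hh]]]. apply Hh; auto.
        rewrite Forall_forall in *. intros y Hy. destruct (HI' y Hy) as [m [_ ->]].
        apply (Hmono (S n) m); [|exact (proj1 (HR m))]. specialize (Hx _ Hy).
        destruct (le_lt_dec m n) as [Hmn|]; [|lia].
        destruct (Nat.eq_dec m n) as [->|]; [lia|]. specialize (Hinc m n); lia. }
    (* Either the colour true recurs forever, or from some [N] on all colours are false. *)
    destruct (classic (unbounded b)) as [HB|HB].
    + apply (Hhom True b HB). tauto.
    + apply not_all_ex_not in HB as [N HN].
      apply (Hhom False (fun n => N <= n)).
      * intros n. exists (n + N). lia.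
      * intros n Hn. split; [|tauto]. intros Hb. apply HN. eauto.
Qed.

Lemma ramsey (k : nat) (c : list nat -> Prop) (H : nat -> Prop) :
  unbounded H -> exists H', unbounded H' /\ subset H' H /\
    (homogeneous k c True H' \/ homogeneous k c False H').
Proof.
  intros HU. destruct (ramsey_unbounded k c H HU) as [H' [b [HU' [HS Hh]]]].
  exists H'. split; [exact HU'|]. split; [exact HS|].
  destruct (classic b) as [Hb|Hb]; [left|right]; intros l H1 H2 H3; rewrite (Hh l H1 H2 H3); tauto.
Qed.

Lemma ramsey_pairs (c : nat -> nat -> Prop) :
  exists h, increasing h /\
    ((forall i j, i < j -> c (h i) (h j)) \/ (forall i j, i < j -> ~ c (h i) (h j))).
Proof.
  destruct (ramsey 2 (fun l => match l with [i; j] => c i j | _ => True end) (fun _ => True))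
    as [H [HU [_ Hh]]].
  { intros n; exists n; auto. }
  destruct (unbounded_enum H HU) as [h [Hinc Hh']]. exists h. split; [exact Hinc|].
  destruct Hh as [Hh|Hh]; [left|right]; intros i j Hij;
    apply Hinc in Hij; rewrite (Hh [h i; h j]); try tauto; repeat constructor; auto.
Qed.

(** * Well partial orders *)

Definition good {X : Type} (le : X -> X -> Prop) : Prop :=
  forall f : nat -> X, exists i j, i < j /\ le (f i) (f j).

(** By Ramsey, a sequence with no increasing pair contains an infinite strictly descending
    subsequence or an infinite antichain. *)
Lemma wpo_good {X : Type} (le : X -> X -> Prop) : wpo le -> good le.
Proof.
  intros [[Hr [Ht Ha]] [Hwf Hanti]] f. apply NNPP. intros Hbad.
  assert (Hb : forall i j, i < j -> ~ le (f i) (f j)) by (intros i j Hij Hle; eauto).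
  destruct (ramsey_pairs (fun i j => le (f j) (f i))) as [h [Hinc [Hh|Hh]]].
  - assert (Hdesc : forall x n, x = f (h n) -> False).
    { intros x. induction x as [x IH] using (well_founded_ind Hwf). intros n ->.
      apply (IH (f (h (S n)))) with (S n); auto. split; [apply Hh; lia|].
      intros E. apply (Hb (h n) (h (S n))); [apply Hinc; lia|]. rewrite E. apply Hr. }
    exact (Hdesc _ 0 eq_refl).
  - apply Hanti. exists (fun n => f (h n)).
    assert (forall i j, i < j -> ~ le (f (h i)) (f (h j)) /\ ~ le (f (h j)) (f (h i))) by auto.
    intros i j Hij. destruct (Nat.lt_total i j) as [|[|]]; [|lia|]; firstorder.
Qed.

(** An infinite descending chain and an infinite antichain are both sequences with no increasing
    pair. *)
Lemma good_wpo {X : Type} (le : X -> X -> Prop) : partial_order le -> good le -> wpo le.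
Proof.
  intros Hpo Hg. pose proof Hpo as [Hr [Ht Ha]]. split; [exact Hpo|split].
  - intros x. apply NNPP. intros Hx.
    destruct (dependent_choice (fun x => ~ Acc (slt le) x) (fun _ x y => slt le y x) x Hx)
      as [f [_ Hf]].
    { intros _ y Hy. apply NNPP. intros Hno. apply Hy. constructor. intros z Hz.
      apply NNPP. intros Hz'. apply Hno. eauto. }
    assert (Hdec : forall i j, i <= j -> le (f j) (f i)).
    { intros i j Hij. induction Hij as [|j Hij IH]; auto.
      apply Ht with (f j); auto. exact (proj1 (proj2 (Hf j))). }
    destruct (Hg f) as [i [j [Hij Hle]]]. destruct (Hf i) as [_ [Hl Hne]].
    apply Hne. apply Ha; auto. apply Ht with (f j); auto.
  - intros [f Hf]. destruct (Hg f) as [i [j [Hij Hle]]].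
    destruct (Hf i j) as [Hn _]; [lia|contradiction].
Qed.

Lemma finite_pigeonhole {Q : Type} (f : nat -> Q) :
  Finite Q -> exists h, increasing h /\ forall i j, i < j -> f (h i) = f (h j).
Proof.
  intros [l Hl]. destruct (ramsey_pairs (fun i j => f i = f j)) as [h [Hinc [Hh|Hh]]]; [eauto|].
  exfalso.
  assert (Hnd : NoDup (map (fun n => f (h n)) (seq 0 (S (length l))))).
  { apply Injective_map_NoDup; [|apply seq_NoDup]. intros i j E.
    destruct (Nat.lt_total i j) as [Hij|[|Hij]]; auto; exfalso;
      apply (Hh _ _ Hij); congruence. }
  apply NoDup_incl_length with (l' := l) in Hnd; [|intros x _; apply Hl].
  rewrite length_map, length_seq in Hnd. lia.
Qed.

Lemma prod_le_po {X Q : Type} (le : X -> X -> Prop) :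
  partial_order le -> partial_order (@prod_le X Q le).
Proof.
  intros [Hr [Ht Ha]]. unfold prod_le. repeat split; auto.
  - destruct H, H0. eauto.
  - destruct H, H0. congruence.
  - intros [x q] [y q'] [H1 H2] [H3 _]; simpl in *. f_equal; auto.
Qed.

Lemma prod_le_wpo {X Q : Type} (le : X -> X -> Prop) :
  wpo le -> Finite Q -> wpo (@prod_le X Q le).
Proof.
  intros Hw HQ. apply good_wpo; [apply prod_le_po, Hw|]. intros f.
  destruct (finite_pigeonhole (fun n => snd (f n)) HQ) as [h [Hinc Hh]].
  destruct (wpo_good le Hw (fun n => fst (f (h n)))) as [i [j [Hij Hle]]].
  exists (h i), (h j). split; [now apply Hinc|]. split; auto.
Qed.

(** * Ideals of an order without Rado's structure *)

(** Three applications of Ramsey make the comparisons inside a row, between separated pairs and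
    between nested pairs uniform. Goodness forces the first two to hold and badness forces the third
    to fail; these facts determine the order on the whole subarray. *)
Lemma rado_of_bad_array {X : Type} (le : X -> X -> Prop) (r : nat -> nat -> X) :
  partial_order le -> good le ->
  (forall i j k, i < j -> j < k -> ~ le (r i j) (r j k)) ->
  exists h, increasing h /\ forall m n m' n', m < n -> m' < n' ->
    (le (r (h m) (h n)) (r (h m') (h n')) <-> rado_le (m, n) (m', n')).
Proof.
  intros [Hr [Ht _]] Hg Hbad.
  destruct (ramsey 3 (fun l => match l with [i; j; k] => le (r i j) (r i k) | _ => True end)
     (fun _ => True)) as [H1 [U1 [_ Hh1]]]; [intros n; exists n; auto|].
  destruct (ramsey 4 (fun l => match l with [i; j; k; m] => le (r i j) (r k m) | _ => True end)
     H1 U1) as [H2 [U2 [S2 Hh2]]].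
  destruct (ramsey 4 (fun l => match l with [i; j; k; m] => le (r j k) (r i m) | _ => True end)
     H2 U2) as [H3 [U3 [S3 Hh3]]].
  destruct (unbounded_enum H3 U3) as [h [Hinc Hh]].
  assert (Ha : forall i j k, i < j -> j <= k -> le (r (h i) (h j)) (r (h i) (h k))).
  { assert (Ha : forall i j k, i < j -> j < k ->
       StronglySorted lt [h i; h j; h k] /\ Forall H1 [h i; h j; h k]).
    { intros i j k Hij Hjk. assert (h i < h j) by auto. assert (h j < h k) by auto.
      split; repeat constructor; auto; lia. }
    destruct Hh1 as [Hh1|Hh1].
    - intros i j k Hij Hjk. destruct (Nat.eq_dec j k) as [->|]; [apply Hr|].
      destruct (Ha i j k) as [HA HB]; [auto|lia|].
      specialize (Hh1 _ HA HB eq_refl). tauto.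
    (* The sequence along a single row has an increasing pair, which excludes the negative
       colour. *)
    - destruct (Hg (fun n => r (h 0) (h (S n)))) as [i [j [Hij Hle]]].
      destruct (Ha 0 (S i) (S j)) as [HA HB]; [lia|lia|].
      specialize (Hh1 _ HA HB eq_refl). tauto. }
  assert (Hs : forall (H : nat -> Prop) i j k m, subset H3 H -> i < j -> j < k -> k < m ->
       StronglySorted lt [h i; h j; h k; h m] /\ Forall H [h i; h j; h k; h m]).
  { intros H i j k m HS Hij Hjk Hkm. apply Hinc in Hij, Hjk, Hkm.
    split; repeat constructor; auto; lia. }
  assert (Hb : forall i j k m, i < j -> j < k -> k < m -> le (r (h i) (h j)) (r (h k) (h m))).
  { destruct Hh2 as [Hh2|Hh2].
    - intros i j k m H4 H5 H6. destruct (Hs H2 i j k m) as [HA HB]; auto.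
      specialize (Hh2 _ HA HB eq_refl). tauto.
    (* Consecutive terms use disjoint pairs of indices, so the increasing pair compares two
       separated entries. *)
    - destruct (Hg (fun n => r (h (2 * n)) (h (2 * n + 1)))) as [i [j [Hij Hle]]].
      destruct (Hs H2 (2 * i) (2 * i + 1) (2 * j) (2 * j + 1)) as [HA HB]; try lia; auto.
      specialize (Hh2 _ HA HB eq_refl). tauto. }
  assert (Hbad' : forall i j k, i < j -> j < k -> ~ le (r (h i) (h j)) (r (h j) (h k))) by auto.
  assert (Hc : forall i j k m, i < j -> j < k -> k < m -> ~ le (r (h j) (h k)) (r (h i) (h m))).
  { destruct Hh3 as [Hh3|Hh3].
    (* Otherwise entry (0,1) is below entry (2,3), which is below the enclosing entry (1,4), against
       badness. *)
    - exfalso. apply (Hbad' 0 1 4); [lia|lia|].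
      apply Ht with (r (h 2) (h 3)); [apply Hb; lia|].
      destruct (Hs H3 1 2 3 4) as [HA HB]; try lia; [intros x Hx; exact Hx|].
      specialize (Hh3 _ HA HB eq_refl). tauto.
    - intros i j k m H4 H5 H6. destruct (Hs H3 i j k m) as [HA HB]; auto; [intros x Hx; exact Hx|].
      specialize (Hh3 _ HA HB eq_refl). tauto. }
  exists h. split; [exact Hinc|]. intros m n m' n' Hmn Hmn'. unfold rado_le; simpl. split.
  - intros Hle. apply NNPP. intros Hno.
    (* For [m < m'] the failure of [rado_le] gives [m' <= n], so entry [(m, m')] is below entry
       [(m', n')]. For equal rows [n' < n], and entry [(m', n)] would be below entry [(n, S n)]. For
       [m' < m] the right-hand entry is pushed along its row past [n], to contradict [Hc]. *)
    destruct (Nat.lt_total m m') as [Hm|[->|Hm]].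
    + apply (Hbad' m m' n'); auto. apply Ht with (r (h m) (h n)); auto. apply Ha; lia.
    + apply (Hbad' m' n (S n)); auto. apply Ht with (r (h m') (h n')); auto. apply Hb; lia.
    + apply (Hc m' m n (S (n + n'))); try lia. apply Ht with (r (h m') (h n')); auto. apply Ha; lia.
  - intros [[-> Hle]|Hlt]; [apply Ha; lia|apply Hb; lia].
Qed.

Lemma idl_eq {X : Type} (le : X -> X -> Prop) (C D : Idl le) :
  (forall x, proj1_sig C x <-> proj1_sig D x) -> C = D.
Proof.
  destruct C as [C HC], D as [D HD]; simpl. intros H.
  assert (E : C = D) by (extensionality x; now apply propositional_extensionality).
  subst D. f_equal. apply proof_irrelevance.
Qed.

Lemma idl_le_po {X : Type} (le : X -> X -> Prop) : partial_order (idl_le le).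
Proof.
  unfold idl_le, subset. repeat split; auto.
  intros C D H1 H2. apply idl_eq. split; auto.
Qed.

(** In a bad sequence of ideals choose [r (i, j)] in [f i] but outside [f j]. If [r (i, j)] were
    below [r (j, k)], downward closure would put it in [f j]; so this is a bad array and Rado's
    structure appears. *)
Lemma idl_good {X : Type} (le : X -> X -> Prop) : omega2_wqo le -> good (idl_le le).
Proof.
  intros [Hw Hrado] f. apply NNPP. intros Hbad.
  assert (Hr : forall p : nat * nat, exists x, fst p < snd p ->
     proj1_sig (f (fst p)) x /\ ~ proj1_sig (f (snd p)) x).
  { intros [i j]; simpl. destruct (proj2_sig (f i)) as [[x0 _] _].
    destruct (classic (i < j)) as [Hij|Hij]; [|exists x0; tauto].
    apply NNPP. intros Hno. apply Hbad. exists i, j. split; auto. intros x Hx.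
    apply NNPP. intros Hx'. apply Hno. eauto. }
  apply functional_choice in Hr as [r Hr].
  destruct (rado_of_bad_array le (fun i j => r (i, j)) (proj1 Hw) (wpo_good le Hw)) as [h [_ Hh]].
  - intros i j k Hij Hjk Hle. apply (Hr (i, j) Hij). simpl.
    destruct (proj2_sig (f j)) as [_ [Hdown _]]. apply Hdown with (r (j, k)); auto.
    now apply (Hr (j, k)).
  - apply Hrado. exists (fun m n => r (h m, h n)). intros; apply Hh; auto.
Qed.

Lemma idl_wpo {X : Type} (le : X -> X -> Prop) : omega2_wqo le -> wpo (idl_le le).
Proof. intros Hw. apply good_wpo; [apply idl_le_po|now apply idl_good]. Qed.

(** * Directed-complete orders *)

Lemma scl_closed {X : Type} (le : X -> X -> Prop) (A : X -> Prop) : scott_closed le (scl le A).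
Proof.
  split.
  - intros x y Hx Hyx C HC HA. destruct (HC) as [Hd _]. apply Hd with x; [now apply Hx|exact Hyx].
  - intros D l HD HDA Hl C HC HA. destruct (HC) as [_ Hd]. apply Hd with D; auto.
    intros x Dx. now apply (HDA x).
Qed.

Lemma scl_incl {X : Type} (le : X -> X -> Prop) (A : X -> Prop) : subset A (scl le A).
Proof. intros x Ax C _ HC. auto. Qed.

Lemma scl_least {X : Type} (le : X -> X -> Prop) (A C : X -> Prop) :
  scott_closed le C -> subset A C -> subset (scl le A) C.
Proof. intros HC HA x Hx. now apply Hx. Qed.

(** Preservation of this two-point lub is how Scott continuity yields monotonicity. *)
Lemma directed_pair {X : Type} (le : X -> X -> Prop) (x y : X) :
  partial_order le -> le x y ->
  directed le (fun z => z = x \/ z = y) /\ is_lub le (fun z => z = x \/ z = y) y.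
Proof.
  intros [Hr _] Hxy. split; split; eauto.
  - intros a b Ha Hb. exists y. repeat split; auto; destruct Ha, Hb; subst; auto.
  - intros d [-> | ->]; auto.
Qed.

Lemma pcont_pmono {X : Type} (le : X -> X -> Prop) (f : X -> option X) :
  partial_order le -> pcont le f -> pmono le f.
Proof.
  intros Hpo [[Hup _] Hlub]. split; [intros x y Hxy Hx; now apply (Hup x)|].
  intros x y x' y' Hxy Ex Ey.
  destruct (directed_pair le x y Hpo Hxy) as [HD Hl].
  assert (Hdom : forall d, d = x \/ d = y -> pdom f d).
  { intros d [-> | ->]; unfold pdom; congruence. }
  apply (Hlub _ _ y' HD Hdom Hl Ey). exists x. auto.
Qed.

Lemma scott_continuous_monotone {X Y : Type} (le1 : X -> X -> Prop) (le2 : Y -> Y -> Prop)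
  (phi : X -> Y) :
  partial_order le1 -> scott_continuous le1 le2 phi -> monotone le1 le2 phi.
Proof.
  intros Hpo Hc x y Hxy. destruct (directed_pair le1 x y Hpo Hxy) as [HD Hl].
  apply (Hc _ _ HD Hl). exists x. auto.
Qed.

Lemma scott_closed_preim {X Y : Type} (le1 : X -> X -> Prop) (le2 : Y -> Y -> Prop)
  (phi : X -> Y) (C : Y -> Prop) :
  partial_order le1 -> scott_continuous le1 le2 phi -> scott_closed le2 C ->
  scott_closed le1 (fun x => C (phi x)).
Proof.
  intros Hpo Hc [Hdown Hlub].
  pose proof (scott_continuous_monotone le1 le2 phi Hpo Hc) as Hmon. split.
  - intros x y Cx Hyx. apply Hdown with (phi x); auto.
  - intros D l HD HDC Hl. apply Hlub with (img phi D); auto.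
    + destruct HD as [[d Dd] Hdir]. split; [exists (phi d), d; auto|].
      intros _ _ [a [Da <-]] [b [Db <-]]. destruct (Hdir a b Da Db) as [c [Dc [Hac Hbc]]].
      exists (phi c). repeat split; auto. exists c; auto.
    + intros _ [d [Dd <-]]. auto.
Qed.

(** Whatever is way below [y] lies below a member of [B], so [B] is cofinal in the way-below set and
    passes its directedness and its lub on to it. *)
Lemma continuous_dcpo_of_approx {X : Type} (le : X -> X -> Prop) :
  dcpo le ->
  (forall y, exists B, directed le B /\ is_lub le B y /\ forall b, B b -> way_below le b y) ->
  continuous_dcpo le.
Proof.
  intros Hd HB. split; [exact Hd|]. destruct Hd as [[Hr [Ht _]] _]. intros y.
  destruct (HB y) as [B [HBd [HBl HBw]]]. destruct (HBd) as [[b Bb] HBdir]. split; split.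
  - exists b. now apply HBw.
  - intros x1 x2 H1 H2.
    destruct (H1 B y HBd HBl (Hr y)) as [b1 [Bb1 Hb1]].
    destruct (H2 B y HBd HBl (Hr y)) as [b2 [Bb2 Hb2]].
    destruct (HBdir b1 b2 Bb1 Bb2) as [c [Bc [Hc1 Hc2]]]. exists c.
    split; [now apply HBw|eauto].
  - intros x Hx. destruct (Hx B y HBd HBl (Hr y)) as [c [Bc Hc]].
    apply Ht with c; auto. now apply HBl.
  - intros u Hu. apply HBl. intros z Bz. now apply Hu, HBw.
Qed.

(** * Products of an order with a discrete set of automaton states *)

Section Product.
Variables (X Q : Type) (le : X -> X -> Prop).

Lemma prod_directed (D : X * Q -> Prop) :
  directed (prod_le le) D -> directed le (img fst D).
Proof.
  intros [[d Dd] Hdir]. split; [exists (fst d), d; auto|].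
  intros _ _ [a [Da <-]] [b [Db <-]]. destruct (Hdir a b Da Db) as [c [Dc [[Hac _] [Hbc _]]]].
  exists (fst c). repeat split; auto. exists c; auto.
Qed.

(** A directed set stays in a single layer, so its lub is computed in the first component. *)
Lemma prod_directed_snd (D : X * Q -> Prop) (a b : X * Q) :
  directed (prod_le le) D -> D a -> D b -> snd a = snd b.
Proof.
  intros [_ Hdir] Da Db. destruct (Hdir a b Da Db) as [c [_ [[_ H1] [_ H2]]]]. congruence.
Qed.

Lemma prod_lub_intro (D : X * Q -> Prop) (l : X) (q : Q) :
  (exists d, D d) -> (forall d, D d -> snd d = q) -> is_lub le (img fst D) l ->
  is_lub (prod_le le) D (l, q).
Proof.
  intros [d0 Dd0] Hq [Hub Hleast]. split.
  - intros d Dd. split; [apply Hub; exists d; auto|now apply Hq].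
  - intros u Hu. split; simpl.
    + apply Hleast. intros _ [d [Dd <-]]. now apply Hu.
    + rewrite <- (Hq d0 Dd0). now apply Hu.
Qed.

Lemma prod_lub_fst (D : X * Q -> Prop) (l : X * Q) :
  directed (prod_le le) D -> is_lub (prod_le le) D l -> is_lub le (img fst D) (fst l).
Proof.
  intros [[d Dd] _] [Hub Hleast]. split.
  - intros _ [a [Da <-]]. now apply Hub.
  - intros u Hu. apply (Hleast (u, snd l)). intros a Da. split; [apply Hu; exists a; auto|].
    now apply Hub.
Qed.

Lemma fst_scott_continuous : scott_continuous (prod_le le) le (@fst X Q).
Proof. intros D l HD Hl. now apply prod_lub_fst. Qed.

Lemma prod_continuous_dcpo : continuous_dcpo le -> continuous_dcpo (@prod_le X Q le).
Proof.
  intros [[Hpo Hlub] Happ]. apply continuous_dcpo_of_approx.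
  - split; [now apply prod_le_po|]. intros D HD.
    destruct (Hlub _ (prod_directed D HD)) as [l Hl].
    destruct (proj1 HD) as [d Dd]. exists (l, snd d). apply prod_lub_intro; auto.
    + exists d; auto.
    + intros a Da. now apply prod_directed_snd with D.
  - intros [y q]. destruct (Happ y) as [[[x0 Hx0] Hdir] Hl].
    exists (fun p => way_below le (fst p) y /\ snd p = q). split; [split|split].
    + exists (x0, q); auto.
    + intros [a qa] [b qb] [Ha Eqa] [Hb Eqb]; simpl in *; subst.
      destruct (Hdir a b Ha Hb) as [c [Hc [Hac Hbc]]]. exists (c, q). repeat split; auto.
    + apply prod_lub_intro.
      * exists (x0, q); auto.
      * now intros d [_ E].
      * split.
        -- intros _ [[a qa] [[Ha _] <-]]. now apply Hl.
        -- intros u Hu. apply Hl. intros x Hx. apply Hu. exists (x, q). auto.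
    + intros [x qx] [Hx E] D l HD HDl [Hyl Eq]; simpl in *; subst.
      destruct (Hx (img fst D) (fst l)) as [_ [[d [Dd <-]] Hxd]]; auto.
      * now apply prod_directed.
      * now apply prod_lub_fst.
      * exists d. split; auto. split; auto. simpl. symmetry. apply HDl, Dd.
Qed.

Variables (L : Type) (tr : L -> X -> option X) (d : Q -> L -> option Q).

Lemma prod_tr_some (a : L) (p p' : X * Q) :
  prod_tr tr d a p = Some p' <->
  tr a (fst p) = Some (fst p') /\ d (snd p) a = Some (snd p').
Proof.
  unfold prod_tr. destruct p' as [x' q']; simpl.
  destruct (tr a (fst p)), (d (snd p) a); split; try intros [? ?]; try congruence.
  intros E; injection E; split; congruence.
Qed.

Lemma prod_tr_dom (a : L) (p : X * Q) :
  pdom (prod_tr tr d a) p <-> pdom (tr a) (fst p) /\ d (snd p) a <> None.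
Proof.
  unfold prod_tr, pdom. destruct (tr a (fst p)), (d (snd p) a); intuition congruence.
Qed.

Lemma prod_tr_pmono (a : L) : pmono le (tr a) -> pmono (prod_le le) (prod_tr tr d a).
Proof.
  intros [Hup Hmon]. split.
  - intros p p' [Hle E]. rewrite !prod_tr_dom, E. intros [H1 H2]. split; eauto.
  - intros p p' r r' [Hle E]. rewrite !prod_tr_some, E. intros [E1 E2] [E3 E4].
    split; [eauto|congruence].
Qed.

Lemma prod_tr_pcont (a : L) : pcont le (tr a) -> pcont (prod_le le) (prod_tr tr d a).
Proof.
  intros [[Hup Hopen] Hcont]. split; [split|].
  - intros p p' Hp [Hle E]. rewrite prod_tr_dom, <- E in *. destruct Hp. split; eauto.
  - intros D l HD Hl Hdom. apply prod_tr_dom in Hdom as [H1 H2].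
    destruct (Hopen _ _ (prod_directed D HD) (prod_lub_fst D l HD Hl) H1) as [_ [[p [Dp <-]] Hp]].
    exists p. split; auto. apply prod_tr_dom. split; auto.
    replace (snd p) with (snd l); auto. symmetry. now apply Hl.
  - intros D l fl HD Hdom Hl El. apply prod_tr_some in El as [E1 E2].
    (* The inline function shows that the first components of members of [D] lie in the domain of
       [tr a]. *)
    assert (Hlub := Hcont _ _ _ (prod_directed D HD)
       (fun x '(ex_intro _ p (conj Dp E)) =>
          eq_ind (fst p) (pdom (tr a)) (proj1 (proj1 (prod_tr_dom a p) (Hdom p Dp))) x E)
       (prod_lub_fst D l HD Hl) E1).
    assert (Hsnd : forall p, D p -> snd p = snd l) by (intros p Dp; now apply Hl).
    destruct fl as [fx fq]; simpl in *. apply prod_lub_intro.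
    + destruct (proj1 HD) as [p Dp]. specialize (Hdom p Dp).
      unfold pdom in Hdom. destruct (prod_tr tr d a p) as [p'|] eqn:E; [|congruence]. eauto.
    + intros p' [p [Dp E]]. apply prod_tr_some in E as [_ E]. rewrite (Hsnd p Dp) in E. congruence.
    + destruct Hlub as [Hub Hleast]. split.
      * intros _ [p' [[p [Dp E]] <-]]. apply prod_tr_some in E as [E _].
        apply Hub. exists (fst p). split; auto. exists p; auto.
      * intros u Hu. apply Hleast. intros y [_ [[p [Dp <-]] E]]. apply Hu.
        exists (y, fq). split; auto. exists p. split; auto. apply prod_tr_some; simpl.
        rewrite (Hsnd p Dp). auto.
Qed.

End Product.

(** * The completion *)

Section Completion.
Variables (X : Type) (le : X -> X -> Prop).

Lemma idl_union_ideal (D : Idl le -> Prop) :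
  directed (idl_le le) D -> ideal le (fun x => exists C, D C /\ proj1_sig C x).
Proof.
  intros [[C DC] Hdir]. split; [|split].
  - destruct (proj2_sig C) as [[x Cx] _]. eauto.
  - intros x y [E [DE Ex]] Hyx. exists E. split; auto.
    destruct (proj2_sig E) as [_ [Hdown _]]. eauto.
  - intros x y [E [DE Ex]] [F [DF Fy]]. destruct (Hdir E F DE DF) as [G [DG [HE HF]]].
    destruct (proj2_sig G) as [_ [_ HG]].
    destruct (HG x y (HE x Ex) (HF y Fy)) as [z [Gz Hz]]. exists z. eauto.
Qed.

Lemma idl_lub_iff (D : Idl le -> Prop) (I : Idl le) : directed (idl_le le) D ->
  (is_lub (idl_le le) D I <-> forall x, proj1_sig I x <-> exists C, D C /\ proj1_sig C x).
Proof.
  intros HD. split.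
  - intros [Hub Hleast] x. split.
    + apply (Hleast (exist _ _ (idl_union_ideal D HD))). intros C DC y Cy. simpl. eauto.
    + intros [C [DC Cx]]. now apply (Hub C).
  - intros H. split.
    + intros C DC x Cx. apply H. eauto.
    + intros U HU x Ix. apply H in Ix as [C [DC Cx]]. now apply (HU C).
Qed.

Lemma idl_dcpo : dcpo (idl_le le).
Proof.
  split; [apply idl_le_po|]. intros D HD. exists (exist _ _ (idl_union_ideal D HD)).
  apply idl_lub_iff; [exact HD|]. simpl. tauto.
Qed.

(** Directed lubs of ideals are unions, so containment in any set [R] survives them. *)
Lemma below_scott_closed (R : X -> Prop) :
  scott_closed (idl_le le) (fun C : Idl le => subset (proj1_sig C) R).
Proof.
  split.
  - intros C D HC HDC x Dx. auto.
  - intros D l HD HDR Hl x lx. rewrite (idl_lub_iff D l HD) in Hl.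
    apply Hl in lx as [C [DC Cx]]. now apply (HDR C).
Qed.

Variable Hpo : partial_order le.

Lemma eta_le (x : X) (C : Idl le) : idl_le le (eta Hpo x) C <-> proj1_sig C x.
Proof.
  split.
  - intros H. apply H. simpl. apply Hpo.
  - intros Cx y Hyx. destruct (proj2_sig C) as [_ [Hdown _]]. eauto.
Qed.

(** Principal ideals are dense: this makes the completion continuous and reduces membership in a
    Scott-closed set to points. *)
Lemma eta_approx (C : Idl le) :
  directed (idl_le le) (fun D => exists x, proj1_sig C x /\ D = eta Hpo x) /\
  is_lub (idl_le le) (fun D => exists x, proj1_sig C x /\ D = eta Hpo x) C.
Proof.
  assert (HD : directed (idl_le le) (fun D => exists x, proj1_sig C x /\ D = eta Hpo x)).
  { destruct (proj2_sig C) as [[x Cx] [_ Hdir]]. split; [exists (eta Hpo x); eauto|].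
    intros _ _ [a [Ca ->]] [b [Cb ->]]. destruct (Hdir a b Ca Cb) as [c [Cc [Hac Hbc]]].
    exists (eta Hpo c). rewrite !eta_le. simpl. eauto. }
  split; [exact HD|]. apply idl_lub_iff; [exact HD|]. intros x. split.
  - intros Cx. exists (eta Hpo x). split; [eauto|]. simpl. apply Hpo.
  - intros [_ [[y [Cy ->]] Hxy]]. destruct (proj2_sig C) as [_ [Hdown _]]. eauto.
Qed.

Lemma idl_continuous_dcpo : continuous_dcpo (idl_le le).
Proof.
  apply continuous_dcpo_of_approx; [apply idl_dcpo|]. intros C.
  destruct (eta_approx C) as [HD Hl]. eexists. split; [exact HD|]. split; [exact Hl|].
  intros b [x [Cx ->]] D l HDd HDl HC. rewrite (idl_lub_iff D l HDd) in HDl.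
  apply HC, HDl in Cx. destruct Cx as [I [DI Ix]]. exists I. rewrite eta_le. auto.
Qed.

Lemma hat_some (f : X -> option X) (Hf : pmono le f) (C D : Idl le) :
  hat Hpo Hf C = Some D ->
  forall y, proj1_sig D y <-> exists x fx, proj1_sig C x /\ f x = Some fx /\ le y fx.
Proof.
  unfold hat. destruct excluded_middle_informative as [H|H]; [|discriminate].
  intros E; injection E; intros <- y. reflexivity.
Qed.

Lemma hat_dom (f : X -> option X) (Hf : pmono le f) (C : Idl le) :
  pdom (hat Hpo Hf) C <-> exists x, proj1_sig C x /\ pdom f x.
Proof.
  unfold hat, pdom at 1. destruct excluded_middle_informative; intuition congruence.
Qed.

Lemma hat_pmono (f : X -> option X) (Hf : pmono le f) : pmono (idl_le le) (hat Hpo Hf).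
Proof.
  split.
  - intros C D HCD. rewrite !hat_dom. intros [x [Cx Hx]]. eauto.
  - intros C D C' D' HCD EC ED y. rewrite (hat_some f Hf C C' EC y), (hat_some f Hf D D' ED y).
    intros [x [fx [Cx H]]]. exists x, fx. auto.
Qed.

(** Membership in the domain or in the image is witnessed by one point, and a point of a directed
    union already lies in a member. *)
Lemma hat_pcont (f : X -> option X) (Hf : pmono le f) : pcont (idl_le le) (hat Hpo Hf).
Proof.
  destruct (hat_pmono f Hf) as [Hup Hmon]. split; [split|].
  - intros C D HC HCD. eauto.
  - intros D l HD Hl Hdom. rewrite (idl_lub_iff D l HD) in Hl.
    apply hat_dom in Hdom as [x [lx Hx]]. apply Hl in lx as [C [DC Cx]].
    exists C. split; auto. apply hat_dom. eauto.
  - intros D l fl HD Hdom Hl El. split.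
    + intros C' [C [DC EC]]. apply Hmon with C l; auto. now apply Hl.
    + intros U HU y Hy. apply (hat_some f Hf l fl El) in Hy as [x [fx [lx [Ex Hy]]]].
      rewrite (idl_lub_iff D l HD) in Hl. apply Hl in lx as [C [DC Cx]].
      specialize (Hdom C DC). unfold pdom in Hdom.
      destruct (hat Hpo Hf C) as [C'|] eqn:EC; [|congruence].
      apply (HU C'); [eauto|]. apply (hat_some f Hf C C' EC). eauto.
Qed.

End Completion.

(** * Bounded languages *)

Section Words.
Variable L : Type.
Implicit Types (u v w : list L) (ws : list (list L)).

Lemma starprod_nil ws : in_starprod ws [].
Proof. induction ws as [|u ws IH]; simpl; [reflexivity|]. now exists 0, []. Qed.

Lemma starprod_app ws1 ws2 w1 w2 :
  in_starprod ws1 w1 -> in_starprod ws2 w2 -> in_starprod (ws1 ++ ws2) (w1 ++ w2).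
Proof.
  revert w1. induction ws1 as [|u ws1 IH]; simpl; intros w1 H1 H2.
  - now subst.
  - destruct H1 as [n [w' [-> H1]]]. exists n, (w' ++ w2). rewrite app_assoc. auto.
Qed.

Lemma starprod_cons u ws w : in_starprod (u :: ws) w -> in_starprod (u :: ws) (u ++ w).
Proof. intros [n [w' [-> H]]]. exists (S n), w'. simpl. now rewrite app_assoc. Qed.

Lemma starprod_tail u ws w : in_starprod ws w -> in_starprod (u :: ws) w.
Proof. intros H. now exists 0, w. Qed.

Lemma starprod_in ws w : In w ws -> in_starprod ws w.
Proof.
  induction ws as [|u ws IH]; intros [].
  - subst u. rewrite <- (app_nil_r w) at 2. apply starprod_cons, starprod_nil.
  - now apply starprod_tail, IH.
Qed.

Lemma starprod_cons_inv u ws a w : in_starprod (u :: ws) (a :: w) ->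
  (exists u' w', u = a :: u' /\ w = u' ++ w' /\ in_starprod (u :: ws) w') \/
  in_starprod ws (a :: w).
Proof.
  intros [n [w' [E H]]]. destruct u as [|b u].
  (* Powers of an empty [u] contribute no letter. *)
  - right. replace (a :: w) with w'; [exact H|]. rewrite E. clear. induction n; simpl; auto.
  - destruct n as [|n]; simpl in E; [right; now subst|]. injection E as -> E.
    left. exists u, (concat (repeat (b :: u) n) ++ w'). rewrite app_assoc. split; [auto|].
    split; [auto|]. now exists n, w'.
Qed.

Lemma finite_prefixes u : exists l, forall v s, u = v ++ s -> In v l.
Proof.
  induction u as [|a u [l Hl]].
  - exists [[]]. intros v s E. symmetry in E. apply app_eq_nil in E as [-> _]. now left.
  - exists ([] :: map (cons a) l). intros [|b v] s E; [now left|right].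
    injection E as <- E. apply in_map. eauto.
Qed.

Lemma finite_suffixes u : exists l, forall v, In v l <-> exists p, u = p ++ v.
Proof.
  induction u as [|a u [l Hl]].
  - exists [[]]. intros v. split.
    + intros [<-|[]]. now exists [].
    + intros [p E]. symmetry in E. apply app_eq_nil in E as [_ ->]. now left.
  - exists ((a :: u) :: l). intros v. split.
    + intros [<-|Hv]; [now exists []|]. apply Hl in Hv as [p ->]. now exists (a :: p).
    + intros [[|b p] E]; [now left|right]. injection E as _ E. apply Hl. eauto.
Qed.

(** Automata recognize prefixes while [flat] asks for the product itself. A prefix either stops
    inside a copy of [u], leaving a prefix of [u], or reaches the remaining factors; adding all
    prefixes of [u] as factors accounts for both. *)
Lemma pfx_starprod_bounded ws :
  exists ws', forall w, pfx (in_starprod ws) w -> in_starprod ws' w.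
Proof.
  induction ws as [|u ws [ws' IH]].
  - exists []. intros w [v E]. simpl in *. now apply app_eq_nil in E as [-> _].
  - destruct (finite_prefixes u) as [l Hl]. exists (u :: l ++ ws').
    intros w [v [n [w' [E H]]]]. revert w E. induction n as [|n IHn]; simpl; intros w E.
    + apply starprod_tail. apply (starprod_app l ws' [] w); [apply starprod_nil|].
      apply IH. exists v. congruence.
    + rewrite <- app_assoc in E. apply app_eq_app in E as [s [[-> E]|[-> E]]].
      * apply starprod_cons, IHn. auto.
      * apply starprod_tail, starprod_in, in_or_app. left. now apply (Hl w s).
Qed.

Lemma starprod_map {L' : Type} (psi : L -> L') ws w :
  in_starprod ws w -> in_starprod (map (map psi) ws) (map psi w).
Proof.
  revert w. induction ws as [|u ws IH]; simpl; intros w H.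
  - now subst.
  - destruct H as [n [w' [-> H]]]. exists n, (map psi w').
    rewrite map_app, concat_map, map_repeat. auto.
Qed.

(* [P] is a union of members of [B]. *)
Definition spanned (B : list (list L -> Prop)) (P : list L -> Prop) : Prop :=
  forall w, P w -> exists b, In b B /\ subset b P /\ b w.

Definition quot (a : L) (P : list L -> Prop) : list L -> Prop := fun w => P (a :: w).

Lemma spanned_quot (B : list (list L -> Prop)) (a : L) (P : list L -> Prop) :
  (forall b, In b B -> spanned B (quot a b)) -> spanned B P -> spanned B (quot a P).
Proof.
  intros HB HP w Hw. destruct (HP _ Hw) as [b [Bb [Hs Hb]]].
  destruct (HB b Bb w Hb) as [c [Bc [Hc Hcw]]]. exists c. split; [exact Bc|].
  split; [|exact Hcw]. intros x Hx. apply Hs, (Hc x Hx).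
Qed.

(** The basis consists of the languages [K v], for [v] a suffix of [u] still to be read, together
    with the basis of the tail. Reading a letter shortens [v]; if [v] is empty, it starts a new copy
    of [u] or moves on to the tail. *)
Lemma starprod_basis ws : exists B, spanned B (in_starprod ws) /\
  forall b a, In b B -> spanned B (quot a b).
Proof.
  induction ws as [|u ws [B' [HP HB']]].
  - exists [fun w => w = []]. split.
    + intros w Hw. eexists. split; [now left|]. split; [intros x Hx; exact Hx|exact Hw].
    + intros b a [<-|[]] w Hw. discriminate Hw.
  - destruct (finite_suffixes u) as [l Hl].
    set (K := fun v w => exists w', w = v ++ w' /\ in_starprod (u :: ws) w').
    assert (HK : forall v p, u = p ++ v -> In (K v) (map K l ++ B')).
    { intros v p E. apply in_or_app. left. apply in_map, Hl. eauto. }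
    exists (map K l ++ B'). split.
    + intros w Hw. exists (K []). split; [apply (HK [] u); now rewrite app_nil_r|].
      split; [|now exists w]. now intros x [x' [-> Hx]].
    + intros b a Hb. apply in_app_or in Hb as [Hb|Hb].
      * apply in_map_iff in Hb as [v [<- Hv]]. apply Hl in Hv as [p Hp].
        intros w [w' [E Hw]]. destruct v as [|c v]; simpl in E.
        -- subst w'. apply starprod_cons_inv in Hw as [[u' [w' [Hu [-> Hw]]]]|Hw].
           ++ exists (K u'). split; [now apply (HK u' [a])|]. split; [|now exists w'].
              intros x [x' [-> Hx]]. exists (u ++ x'). split; [now rewrite Hu|].
              now apply starprod_cons.
           ++ destruct (spanned_quot B' a _ (fun b => HB' b a) HP w Hw) as [c [Hc [Hs Hcw]]].
              exists c. split; [apply in_or_app; now right|]. split; [|exact Hcw].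
              intros x Hx. exists (a :: x). split; [reflexivity|].
              apply starprod_tail, (Hs x Hx).
        -- injection E as <- E. exists (K v). split.
           ++ apply (HK v (p ++ [a])). now rewrite <- app_assoc.
           ++ split; [|now exists w']. intros x [x' [-> Hx]]. now exists x'.
      * intros w Hw. destruct (HB' b a Hb w Hw) as [c [Hc Hs]].
        exists c. split; [apply in_or_app; now right|exact Hs].
Qed.

Fixpoint sublists {A : Type} (l : list A) : list (list A) :=
  match l with
  | [] => [[]]
  | x :: l' => sublists l' ++ map (cons x) (sublists l')
  end.

Lemma filter_sublists {A : Type} (p : A -> bool) (l : list A) : In (filter p l) (sublists l).
Proof.
  induction l as [|x l IH]; simpl; [now left|]. apply in_or_app.
  destruct (p x); [right; now apply in_map|now left].
Qed.

Lemma finite_sig {A : Type} (P : A -> Prop) (l : list A) :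
  (forall x, P x -> In x l) -> Finite {x | P x}.
Proof.
  intros Hl.
  exists (flat_map (fun x => match excluded_middle_informative (P x) with
                             | left H => [exist P x H] | right _ => [] end) l).
  intros [x Hx]. apply in_flat_map. exists x. split; [auto|].
  destruct excluded_middle_informative as [H|H]; [left|contradiction].
  f_equal. apply proof_irrelevance.
Qed.

(** A spanned [P] is the union of the basis members contained in it, hence determined by a sublist
    of [B]. *)
Lemma finite_spanned (B : list (list L -> Prop)) (E : (list L -> Prop) -> Prop) :
  Finite {P | spanned B P /\ E P}.
Proof.
  apply finite_sig with (map (fun S w => exists b, In b S /\ b w) (sublists B)).
  intros P [HP _]. apply in_map_iff.
  set (p := fun b => if excluded_middle_informative (subset b P) then true else false).
  exists (filter p B). split; [|apply filter_sublists].
  extensionality w. apply propositional_extensionality. split.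
  - intros [b [Hb Hbw]]. apply filter_In in Hb as [_ Hb]. unfold p in Hb.
    destruct excluded_middle_informative as [Hs|]; [now apply Hs|discriminate].
  - intros Hw. destruct (HP w Hw) as [b [Bb [Hs Hb]]]. exists b. split; [|exact Hb].
    apply filter_In. split; [exact Bb|]. unfold p.
    now destruct excluded_middle_informative.
Qed.

(* The states are the nonempty left quotients of the language of [ws]. *)
Lemma rl_automaton_exists ws : exists (Q : Type) (d : Q -> L -> option Q) (q0 : Q),
  Finite Q /\ forall w, drun d q0 w <> None <-> pfx (in_starprod ws) w.
Proof.
  destruct (starprod_basis ws) as [B [HP HB]].
  set (Q := {P | spanned B P /\ exists w, P w}).
  set (d := fun (q : Q) a =>
    match excluded_middle_informative (exists w, quot a (proj1_sig q) w) with
    | left H => Some (exist (fun P => spanned B P /\ exists w, P w) (quot a (proj1_sig q))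
         (conj (spanned_quot B a _ (fun b => HB b a) (proj1 (proj2_sig q))) H))
    | right _ => None
    end).
  exists Q, d, (exist _ (in_starprod ws) (conj HP (ex_intro _ [] (starprod_nil ws)))).
  split; [apply finite_spanned|].
  (* No state is the empty language, so a run survives exactly as long as the word read can be
     completed; this is what makes the automaton accept prefixes. *)
  assert (Hd : forall w (q : Q), drun d q w <> None <-> exists v, proj1_sig q (w ++ v)).
  { induction w as [|a w IH]; intros q; simpl.
    - destruct q as [P [HPs [v Hv]]]; simpl. split; [eauto|discriminate].
    - unfold d at 1. destruct excluded_middle_informative as [H|H].
      + rewrite IH. reflexivity.
      + split; [congruence|]. intros [v Hv]. exfalso. apply H. now exists (w ++ v). }
  intros w. apply Hd.
Qed.

End Words.

(** * Runs, covers and products *)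

Section Runs.
Variables (X L : Type) (le : X -> X -> Prop) (tr : L -> X -> option X).

Lemma wrun_app (w v : list L) (x : X) :
  wrun tr (w ++ v) x = match wrun tr w x with Some y => wrun tr v y | None => None end.
Proof.
  revert x. induction w as [|a w IH]; intros x; simpl; [reflexivity|].
  destruct (tr a x); auto.
Qed.

Lemma wrun_iter (g : list L) (n : nat) (x : X) :
  iter_opt (wrun tr g) n x = wrun tr (concat (repeat g n)) x.
Proof.
  revert x. induction n as [|n IH]; intros x; simpl; [reflexivity|].
  rewrite wrun_app. destruct (wrun tr g x); auto.
Qed.

Hypothesis Hpo : partial_order le.
Hypothesis Hm : forall a, pmono le (tr a).

Lemma wrun_pmono (w : list L) : pmono le (wrun tr w).
Proof.
  induction w as [|a w [IHdom IHmon]].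
  - split; simpl; [discriminate|congruence].
  - destruct (Hm a) as [Hdom Hmon]. split; simpl.
    + intros x y Hxy. unfold pdom; simpl. specialize (Hdom x y Hxy). unfold pdom in Hdom.
      destruct (tr a x) as [x'|] eqn:Ex; [|congruence].
      destruct (tr a y) as [y'|] eqn:Ey; [|intros _; apply Hdom; congruence].
      apply IHdom. eauto.
    + intros x y x' y' Hxy.
      destruct (tr a x) as [x1|] eqn:Ex; [|congruence].
      destruct (tr a y) as [y1|] eqn:Ey; [|congruence]. eauto.
Qed.

Lemma wrun_mono (w : list L) (x y x' : X) :
  le x y -> wrun tr w x = Some x' -> exists y', wrun tr w y = Some y' /\ le x' y'.
Proof.
  intros Hxy Ex. destruct (wrun_pmono w) as [Hdom Hmon].
  destruct (wrun tr w y) as [y'|] eqn:Ey; [eauto|].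
  exfalso. apply (Hdom x y Hxy); unfold pdom; congruence.
Qed.

(** By monotonicity a run from a point below [x0] can be replayed from [x0], ending higher. *)
Lemma cover_iff (x0 x : X) :
  cover le tr x0 x <-> exists w y, wrun tr w x0 = Some y /\ le x y.
Proof.
  destruct Hpo as [Hr [Ht _]]. split.
  - intros [y [[x' [Hx' [w Hw]]] Hxy]].
    destruct (wrun_mono w x' x0 y Hx' Hw) as [z [Hz Hyz]]. eauto.
  - intros [w [y [Hw Hxy]]]. exists y. split; [|exact Hxy]. exists x0. split; [apply Hr|now exists w].
Qed.

Definition covered_along (W : list L -> Prop) (x0 x : X) : Prop :=
  exists w y, W w /\ wrun tr w x0 = Some y /\ le x y.

(* The pivot: every flattability notion and the termination of the Clover procedure
   are equivalent to it. *)
Definition flatly_covered (x0 : X) : Prop :=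
  exists ws, subset (cover le tr x0) (covered_along (in_starprod ws) x0).

Variables (Q : Type) (d : Q -> L -> option Q).

Lemma prod_wrun (w : list L) (x x' : X) (q q' : Q) :
  wrun (prod_tr tr d) w (x, q) = Some (x', q') <->
  wrun tr w x = Some x' /\ drun d q w = Some q'.
Proof.
  revert x q. induction w as [|a w IH]; intros x q; simpl.
  - split; [intros E; injection E; split; congruence|intros [E1 E2]; congruence].
  - unfold prod_tr at 1; simpl.
    destruct (tr a x), (d q a); try (split; [discriminate|intros []; discriminate]).
    apply IH.
Qed.

Lemma cover_prod (x0 : X) (q0 : Q) (p : X * Q) :
  cover (prod_le le) (prod_tr tr d) (x0, q0) p <->
  exists w y, wrun tr w x0 = Some y /\ drun d q0 w = Some (snd p) /\ le (fst p) y.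
Proof.
  destruct Hpo as [Hr [Ht _]]. split.
  - intros [[y q] [[[x' q'] [[Hx' E] [w Hw]]] [Hxy E']]]; simpl in *; subst.
    apply prod_wrun in Hw as [Hw Hd].
    destruct (wrun_mono w x' x0 y Hx' Hw) as [z [Hz Hyz]]. exists w, z. eauto.
  - intros [w [y [Hw [Hd Hxy]]]]. exists (y, snd p). split; [|split; auto].
    exists (x0, q0). split; [split; auto|]. exists w. now apply prod_wrun.
Qed.

Lemma cover_prod_fst (x0 : X) (q0 : Q) (x : X) :
  img fst (cover (prod_le le) (prod_tr tr d) (x0, q0)) x <->
  covered_along (fun w => drun d q0 w <> None) x0 x.
Proof.
  split.
  - intros [p [Hp <-]]. apply cover_prod in Hp as [w [y [Hw [Hd Hxy]]]].
    exists w, y. split; [congruence|auto].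
  - intros [w [y [Hd [Hw Hxy]]]]. destruct (drun d q0 w) as [q|] eqn:E; [|congruence].
    exists (x, q). split; [|reflexivity]. apply cover_prod. eauto.
Qed.

Lemma rl_automaton_flat (x0 : X) (q0 : Q) :
  rl_automaton d q0 -> flat (prod_tr tr d) (x0, q0).
Proof.
  intros [_ [ws Hws]]. destruct (pfx_starprod_bounded L ws) as [ws' Hws'].
  exists ws'. intros w Hw. apply Hws', Hws.
  destruct (wrun (prod_tr tr d) w (x0, q0)) as [[x q]|] eqn:E; [|congruence].
  apply prod_wrun in E as [_ E]. congruence.
Qed.

End Runs.

Arguments covered_along {X L}.
Arguments flatly_covered {X L}.

Lemma morphism_wrun {S1 L1 S2 L2 : Type} (tr1 : L1 -> S1 -> option S1)
  (tr2 : L2 -> S2 -> option S2) (phi : S1 -> S2) (psi : L1 -> L2) (w : list L1) (s s' : S1) :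
  morphism tr1 tr2 phi psi -> wrun tr1 w s = Some s' ->
  wrun tr2 (map psi w) (phi s) = Some (phi s').
Proof.
  intros Hmor. revert s. induction w as [|a w IH]; simpl; intros s E; [congruence|].
  destruct (tr1 a s) as [t|] eqn:Ea; [|discriminate]. rewrite (Hmor _ _ _ Ea). auto.
Qed.

Lemma fst_morphism {X L Q : Type} (tr : L -> X -> option X) (d : Q -> L -> option Q) :
  morphism (prod_tr tr d) tr fst (fun a => a).
Proof. intros a p p' E. now apply prod_tr_some in E. Qed.

(** * Flattability notions for covers *)

Section CoverFlattable.
Variables (X L : Type) (le : X -> X -> Prop) (tr : L -> X -> option X) (x0 : X).
Hypothesis Hpo : partial_order le.
Hypothesis HL : Finite L.
Hypothesis Hm : forall a, pmono le (tr a).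

Lemma weakly_cover_flatly_covered :
  weakly_cover_flattable le tr x0 -> flatly_covered le tr x0.
Proof.
  intros [Y [L1 [le1 [tr1 [phi [psi [x1 H]]]]]]].
  destruct H as [[_ [Hpo1 [Hm1 [ws Hws]]]] [Hmor [Hphi [Hx1 Hcov]]]].
  exists (map (map psi) ws). intros x Hx. apply Hcov in Hx as [_ [[y [Hy <-]] Hxy]].
  apply cover_iff in Hy as [w [z [Hw Hyz]]]; auto.
  destruct (wrun_mono X L le tr Hm _ _ _ _ Hx1 (morphism_wrun _ _ _ _ _ _ _ Hmor Hw))
    as [z' [Hz' Hzz']].
  exists (map psi w), z'. split; [|split].
  - apply starprod_map, Hws. congruence.
  - exact Hz'.
  - pose proof (proj1 (proj2 Hpo)) as Ht. eauto.
Qed.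

Lemma flatly_covered_strongly :
  flatly_covered le tr x0 -> strongly_cover_flattable le tr x0.
Proof.
  intros [ws Hws]. destruct (rl_automaton_exists L ws) as [Q [d [q0 [HQ Hd]]]].
  exists Q, d, q0. split; [split; eauto|]. intros x. rewrite cover_prod_fst; auto. split.
  - intros Hx. destruct (Hws x Hx) as [w [y [Hw Hy]]]. exists w, y. split; [|exact Hy].
    apply Hd. exists []. now rewrite app_nil_r.
  - intros [w [y [_ Hy]]]. apply cover_iff; eauto.
Qed.

Lemma strongly_cover_flattable_cover :
  strongly_cover_flattable le tr x0 -> cover_flattable le tr x0.
Proof.
  intros [Q [d [q0 [Hrl Hcov]]]].
  exists (X * Q)%type, L, (prod_le le), (prod_tr tr d), fst, (fun a => a), (x0, q0).
  split; [|split; [|split; [|split]]].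
  - split; [exact HL|]. split; [now apply prod_le_po|].
    split; [intros a; now apply prod_tr_pmono|now apply rl_automaton_flat].
  - apply fst_morphism.
  - intros p p' Hp. apply Hp.
  - reflexivity.
  (* The projected cover is already downward closed, so closing it again adds nothing. *)
  - intros x. rewrite (Hcov x). split.
    + intros Hx. exists x. split; [exact Hx|apply Hpo].
    + intros [y [Hy Hxy]]. rewrite cover_prod_fst in *; auto.
      destruct Hy as [w [z [Hd [Hw Hyz]]]]. exists w, z. pose proof (proj1 (proj2 Hpo)) as Ht. eauto.
Qed.

Lemma cover_flattable_weakly :
  cover_flattable le tr x0 -> weakly_cover_flattable le tr x0.
Proof.
  intros [Y [L1 [le1 [tr1 [phi [psi [x1 [H1 [H2 [H3 [H4 H5]]]]]]]]]]].
  exists Y, L1, le1, tr1, phi, psi, x1. repeat (split; [assumption|]). split.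
  - rewrite H4. apply Hpo.
  - intros x. apply H5.
Qed.

End CoverFlattable.

(** * Flattability notions for clovers *)

Section CloverFlattable.
Variables (X L : Type) (le : X -> X -> Prop) (tr : L -> X -> option X) (x0 : X).

Lemma complete_ts_po : complete_ts le tr -> partial_order le.
Proof. intros [_ [_ [Hw _]]]. apply Hw. Qed.

Lemma complete_ts_pmono : complete_ts le tr -> forall a, pmono le (tr a).
Proof. intros Hc a. apply pcont_pmono; [now apply complete_ts_po|apply Hc]. Qed.

Lemma prod_complete_ts {Q : Type} (d : Q -> L -> option Q) :
  complete_ts le tr -> Finite Q -> complete_ts (prod_le le) (prod_tr tr d).
Proof.
  intros [HL [Hd [Hw Hc]]] HQ. split; [exact HL|]. split; [now apply prod_continuous_dcpo|].
  split; [now apply prod_le_wpo|]. intros a. apply prod_tr_pcont, Hc.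
Qed.

Lemma strongly_clover_flattable_clover :
  complete_ts le tr -> strongly_clover_flattable le tr x0 -> clover_flattable le tr x0.
Proof.
  intros Hc [Q [d [q0 [Hrl Hcov]]]].
  exists (X * Q)%type, L, (prod_le le), (prod_tr tr d), fst, (fun a => a), (x0, q0).
  split; [|split; [|split; [|split]]].
  - split; [|now apply rl_automaton_flat]. apply prod_complete_ts; [exact Hc|apply Hrl].
  - apply fst_morphism.
  - apply fst_scott_continuous.
  - reflexivity.
  - exact Hcov.
Qed.

Lemma clover_flattable_weakly :
  partial_order le -> clover_flattable le tr x0 -> weakly_clover_flattable le tr x0.
Proof.
  intros Hpo [Y [L1 [le1 [tr1 [phi [psi [x1 [H1 [H2 [H3 [H4 H5]]]]]]]]]]].
  exists Y, L1, le1, tr1, phi, psi, x1. repeat (split; [assumption|]). split.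
  - rewrite H4. apply Hpo.
  - intros x. apply H5.
Qed.

End CloverFlattable.

(** * Clover-flattability of the completion *)

Section CompletionClover.
Variables (X L : Type) (le : X -> X -> Prop) (tr : L -> X -> option X).
Hypothesis Hpo : partial_order le.
Hypothesis Hm : forall a, pmono le (tr a).

(** Monotonicity makes the downward closures taken at intermediate steps redundant, so a run on
    ideals is described by runs on points. *)
Lemma hat_wrun (w : list L) (C D : Idl le) :
  wrun (hat_tr Hpo Hm) w C = Some D ->
  forall y, proj1_sig D y <-> exists x z, proj1_sig C x /\ wrun tr w x = Some z /\ le y z.
Proof.
  revert C. induction w as [|a w IH]; simpl; intros C E y.
  - injection E as <-. split.
    + intros Cy. exists y, y. repeat split; auto. apply Hpo.
    + intros [x [z [Cx [Ez Hyz]]]]. injection Ez as <-.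
      destruct (proj2_sig C) as [_ [Hdown _]]. eauto.
  - destruct (hat_tr Hpo Hm a C) as [C'|] eqn:EC; [|discriminate].
    rewrite (IH C' E y). split.
    + intros [x' [z [Cx' [Ez Hyz]]]]. apply (hat_some X le Hpo _ _ _ _ EC) in Cx'.
      destruct Cx' as [x [fx [Cx [Ex Hx]]]].
      destruct (wrun_mono X L le tr Hm w x' fx z Hx Ez) as [z' [Ez' Hz']].
      exists x, z'. rewrite Ex. pose proof (proj1 (proj2 Hpo)) as Ht. eauto.
    + intros [x [z [Cx [Ez Hyz]]]]. destruct (tr a x) as [fx|] eqn:Ex; [|discriminate].
      exists fx, z. split; auto. apply (hat_some X le Hpo _ _ _ _ EC).
      exists x, fx. split; auto. split; auto. apply Hpo.
Qed.

Lemma hat_wrun_dom (w : list L) (C : Idl le) (x z : X) :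
  proj1_sig C x -> wrun tr w x = Some z -> exists D, wrun (hat_tr Hpo Hm) w C = Some D.
Proof.
  revert C x. induction w as [|a w IH]; simpl; intros C x Cx Ez; [eauto|].
  destruct (tr a x) as [fx|] eqn:Ex; [|discriminate].
  destruct (hat_tr Hpo Hm a C) as [C'|] eqn:EC.
  - apply IH with fx; auto. apply (hat_some X le Hpo _ _ _ _ EC).
    exists x, fx. split; auto. split; auto. apply Hpo.
  - exfalso. apply (hat_dom X le Hpo (tr a) (Hm a) C); [|exact EC].
    exists x. split; auto. unfold pdom. congruence.
Qed.

Lemma hat_tr_pmono (a : L) : pmono (idl_le le) (hat_tr Hpo Hm a).
Proof. apply hat_pmono. Qed.

Lemma hat_complete_ts :
  omega2_wqo le -> Finite L -> complete_ts (idl_le le) (hat_tr Hpo Hm).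
Proof.
  intros Hw HL. split; [exact HL|]. split; [now apply idl_continuous_dcpo|].
  split; [now apply idl_wpo|]. intros a. apply hat_pcont.
Qed.

Variable x0 : X.
Let s0 := eta Hpo x0.

Lemma hat_cover_iff (C : Idl le) :
  cover (idl_le le) (hat_tr Hpo Hm) s0 C <->
  exists w D, wrun (hat_tr Hpo Hm) w s0 = Some D /\ idl_le le C D.
Proof. apply cover_iff; [apply idl_le_po|apply hat_tr_pmono]. Qed.

Lemma hat_wrun_eta (w : list L) (D : Idl le) (y : X) :
  wrun (hat_tr Hpo Hm) w s0 = Some D -> proj1_sig D y ->
  exists z, wrun tr w x0 = Some z /\ le y z.
Proof.
  intros E Dy. apply (hat_wrun w s0 D E) in Dy as [x [z [Hx [Ez Hyz]]]].
  destruct (wrun_mono X L le tr Hm w x x0 z Hx Ez) as [z' [Ez' Hz']].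
  exists z'. pose proof (proj1 (proj2 Hpo)) as Ht. eauto.
Qed.

Lemma wrun_eta (w : list L) (y z : X) : wrun tr w x0 = Some z -> le y z ->
  exists D, wrun (hat_tr Hpo Hm) w s0 = Some D /\ proj1_sig D y.
Proof.
  intros Ez Hyz. assert (Hx0 : proj1_sig s0 x0) by apply Hpo.
  destruct (hat_wrun_dom w s0 x0 z Hx0 Ez) as [D ED]. exists D. split; auto.
  apply (hat_wrun w s0 D ED). eauto.
Qed.

Lemma cover_eta (x : X) :
  cover le tr x0 x <-> cover (idl_le le) (hat_tr Hpo Hm) s0 (eta Hpo x).
Proof.
  rewrite hat_cover_iff, cover_iff; auto. split.
  - intros [w [z [Ez Hxz]]]. destruct (wrun_eta w x z Ez Hxz) as [D [ED Dx]].
    exists w, D. split; auto. now apply eta_le.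
  - intros [w [D [ED Dx]]]. apply eta_le in Dx.
    destruct (hat_wrun_eta w D x ED Dx) as [z Hz]. eauto.
Qed.

Lemma hat_cover_below (C : Idl le) :
  cover (idl_le le) (hat_tr Hpo Hm) s0 C -> subset (proj1_sig C) (cover le tr x0).
Proof.
  rewrite hat_cover_iff. intros [w [D [ED HCD]]] x Cx. apply cover_iff; auto.
  destruct (hat_wrun_eta w D x ED (HCD x Cx)) as [z Hz]. eauto.
Qed.

Lemma flatly_covered_strongly_clover :
  flatly_covered le tr x0 -> strongly_clover_flattable (idl_le le) (hat_tr Hpo Hm) s0.
Proof.
  intros [ws Hws]. destruct (rl_automaton_exists L ws) as [Q [d [q0 [HQ Hd]]]].
  exists Q, d, q0. split; [split; eauto|].
  assert (Hpm := hat_tr_pmono). assert (Hip := idl_le_po le).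
  assert (Heta : forall x, cover le tr x0 x ->
     img fst (cover (prod_le (idl_le le)) (prod_tr (hat_tr Hpo Hm) d) (s0, q0)) (eta Hpo x)).
  { intros x Hx. destruct (Hws x Hx) as [w [y [Hw [Ey Hxy]]]].
    destruct (wrun_eta w x y Ey Hxy) as [D [ED Dx]].
    apply cover_prod_fst; auto. exists w, D. split; [|split; auto].
    - apply Hd. exists []. now rewrite app_nil_r.
    - now apply eta_le. }
  intros C. split.
  (* [C] is the lub of the principal ideals of its points, so it suffices to place these in the
     right-hand closure. Its points lie in the cover of [x0] because the ideals contained in that
     cover form a Scott-closed set. *)
  - intros HC. destruct (eta_approx X le Hpo C) as [HD Hl].
    apply (proj2 (scl_closed (idl_le le) _) _ C HD); [|exact Hl].
    intros D [x [Cx ->]]. apply scl_incl.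
    assert (HC' : subset (proj1_sig C) (cover le tr x0)).
    { apply (scl_least (idl_le le) _ (fun C => subset (proj1_sig C) _))
        with (3 := HC); [apply below_scott_closed|exact hat_cover_below]. }
    destruct (Heta x (HC' x Cx)) as [p [Hp E]]. exists p. split; auto. now apply scl_incl.
  - apply scl_least; [apply scl_closed|]. intros _ [p [Hp <-]]. revert p Hp.
    apply scl_least.
    + apply scott_closed_preim with (le2 := idl_le le);
        [now apply prod_le_po|apply fst_scott_continuous|apply scl_closed].
    + intros p Hp. apply scl_incl, cover_iff; auto. apply cover_prod in Hp; auto.
      destruct Hp as [w [y [Hw [_ Hy]]]]. eauto.
Qed.

Lemma weakly_clover_flatly_covered :
  weakly_clover_flattable (idl_le le) (hat_tr Hpo Hm) s0 -> flatly_covered le tr x0.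
Proof.
  intros [Y [L1 [le1 [tr1 [phi [psi [s1 H]]]]]]].
  destruct H as [[Hc [ws Hws]] [Hmor [Hphi [Hs1 Hcov]]]].
  pose proof (complete_ts_po _ _ _ _ Hc) as Hpo1.
  pose proof (complete_ts_pmono _ _ _ _ Hc) as Hm1.
  pose proof (scott_continuous_monotone _ _ _ Hpo1 Hphi) as Hmon.
  exists (map (map psi) ws).
  (* The target is Scott-closed and so is its preimage under [phi]. This removes the outer and then
     the inner closure, leaving only actual runs of the flattening. *)
  assert (Hbelow : subset (cover (idl_le le) (hat_tr Hpo Hm) s0)
     (fun C => subset (proj1_sig C) (covered_along le tr (in_starprod (map (map psi) ws)) x0))).
  { intros C HC. apply (scl_incl (idl_le le)), Hcov in HC. revert C HC.
    apply scl_least; [apply below_scott_closed|]. intros _ [s [Hs <-]]. revert s Hs.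
    apply scl_least.
    - apply (scott_closed_preim le1 (idl_le le) phi (fun C => subset (proj1_sig C) _)); auto.
      apply below_scott_closed.
    - intros s Hs. apply cover_iff in Hs as [w [t [Et Hst]]]; auto.
      intros x Hx. apply (Hmon _ _ Hst) in Hx.
      apply (morphism_wrun _ _ _ _ _ _ _ Hmor) in Et as Et'.
      destruct (wrun_mono _ _ _ _ hat_tr_pmono _ _ _ _ Hs1 Et') as [D [ED HD]].
      destruct (hat_wrun_eta _ D x ED (HD x Hx)) as [z Hz].
      exists (map psi w), z. split; [|exact Hz]. apply starprod_map, Hws. congruence. }
  intros x Hx. apply cover_eta in Hx. apply (Hbelow _ Hx). simpl. apply Hpo.
Qed.

End CompletionClover.

(** * Lub-acceleration *)

Section Acceleration.
Variables (X : Type) (le : X -> X -> Prop) (g : X -> option X).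
Hypothesis Hpo : partial_order le.
Hypothesis Hg : pmono le g.

Lemma iter_chain (n : nat) (x gx : X) : g x = Some gx -> le x gx ->
  exists y y', iter_opt g n x = Some y /\ iter_opt g (S n) x = Some y' /\ le y y'.
Proof.
  destruct Hg as [Hdom Hmon]. revert x gx. induction n as [|n IH]; intros x gx E Hle.
  - exists x, gx. simpl. rewrite E. auto.
  - assert (Hd : pdom g gx) by (apply (Hdom x gx Hle); unfold pdom; congruence).
    unfold pdom in Hd. destruct (g gx) as [ggx|] eqn:E'; [|congruence].
    destruct (IH gx ggx E' (Hmon _ _ _ _ Hle E E')) as [y [y' [H1 [H2 H3]]]].
    exists y, y'. simpl in *. rewrite E. auto.
Qed.

Lemma iter_directed (x gx : X) : g x = Some gx -> le x gx ->
  directed le (fun z => exists n, iter_opt g n x = Some z).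
Proof.
  intros E Hle. pose proof Hpo as [Hr [Ht _]].
  assert (Hmono : forall i j y z, i <= j ->
    iter_opt g i x = Some y -> iter_opt g j x = Some z -> le y z).
  { intros i j y z Hij Ey. revert z. induction Hij as [|j Hij IH]; intros z Ez.
    - replace z with y by congruence. apply Hr.
    - destruct (iter_chain j x gx E Hle) as [y1 [y2 [E1 [E2 H12]]]].
      apply Ht with y1; [now apply IH|]. congruence. }
  split; [now exists x, 0|]. intros y z [i Ei] [j Ej].
  destruct (Nat.le_ge_cases i j) as [Hij|Hij]; [exists z|exists y]; eauto 6.
Qed.

Lemma accel_exists (x : X) : dcpo le -> pdom g x -> exists y, is_accel le g x y.
Proof.
  intros [_ Hlub] Hx. unfold pdom in Hx. destruct (g x) as [gx|] eqn:E; [|congruence].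
  destruct (classic (slt le x gx)) as [Hs|Hs].
  - destruct (Hlub _ (iter_directed x gx E (proj1 Hs))) as [y Hy]. exists y, gx. auto.
  - exists gx, gx. auto.
Qed.

Lemma accel_ge (x gx y : X) : is_accel le g x y -> g x = Some gx -> le gx y.
Proof.
  intros [gx' [E' H]] E. replace gx' with gx in * by congruence.
  destruct H as [[_ [Hub _]]|[_ ->]]; [|apply Hpo].
  apply Hub. exists 1. simpl. now rewrite E.
Qed.

End Acceleration.

Lemma repeat_concat_add {L : Type} (u : list L) (n m : nat) :
  concat (repeat u (n + m)) = concat (repeat u n) ++ concat (repeat u m).
Proof. now rewrite repeat_app, concat_app. Qed.

Lemma repeat_concat_mul {L : Type} (u : list L) (p n : nat) :
  concat (repeat u (p * n)) = concat (repeat (concat (repeat u p)) n).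
Proof.
  induction n as [|n IH]; [now rewrite Nat.mul_0_r|].
  rewrite Nat.mul_succ_r, Nat.add_comm, repeat_concat_add, IH. reflexivity.
Qed.

(* [U] stands for the set of all states collected along a fair run. *)
Section AccelerationClosed.
Variables (X L : Type) (le : X -> X -> Prop) (tr : L -> X -> option X) (U : X -> Prop).
Hypothesis Hpo : partial_order le.
Hypothesis Hm : forall a, pmono le (tr a).
Hypothesis Hgood : good le.
Hypothesis HU : forall a g, U a -> pdom (wrun tr g) a ->
  exists y, U y /\ is_accel le (wrun tr g) a y.

Let covers (B : list X) (t : X) : Prop := exists b, In b B /\ le t b.

Lemma covers_app_l (B C : list X) (t : X) : covers B t -> covers (B ++ C) t.
Proof. intros [b [Hb Hle]]. exists b. split; [apply in_or_app|]; auto. Qed.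

Lemma covers_app_r (B C : list X) (t : X) : covers C t -> covers (B ++ C) t.
Proof. intros [b [Hb Hle]]. exists b. split; [apply in_or_app|]; auto. Qed.

Lemma Forall_app_intro (B C : list X) : Forall U B -> Forall U C -> Forall U (B ++ C).
Proof. intros. now apply Forall_app. Qed.

(** If [a] is fixed by [g] it bounds its own iterates; otherwise [a] is strictly increased and the
    collected acceleration is the lub of the iterates. *)
Lemma accel_powers (a b : X) (g : list L) :
  U a -> wrun tr g a = Some b -> le a b ->
  exists d, U d /\ forall n z, wrun tr (concat (repeat g n)) a = Some z -> le z d.
Proof.
  intros Ua E Hab. destruct (classic (a = b)) as [<-|Hne].
  - exists a. split; [exact Ua|]. induction n as [|n IH]; simpl; intros z Ez.
    + injection Ez as <-. apply Hpo.
    + rewrite wrun_app, E in Ez. auto.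
  - destruct (HU a g Ua) as [y [Uy [b' [E' Hy]]]]; [unfold pdom; congruence|].
    replace b' with b in * by congruence. destruct Hy as [[_ [Hub _]]|[Hn _]].
    + exists y. split; [exact Uy|]. intros n z Ez. apply Hub. exists n. now rewrite wrun_iter.
    + exfalso. apply Hn. now split.
Qed.

(** An acceleration is at least one plain application, so each defined power is bounded by its own
    acceleration. *)
Lemma small_powers_covered (a : X) (u : list L) (N : nat) : U a ->
  exists B, Forall U B /\
    forall n z, n < N -> wrun tr (concat (repeat u n)) a = Some z -> covers B z.
Proof.
  intros Ua. induction N as [|N [B [UB HB]]].
  - exists []. split; [constructor|]. intros; lia.
  - destruct (wrun tr (concat (repeat u N)) a) as [z|] eqn:E.
    + destruct (HU a (concat (repeat u N)) Ua) as [y [Uy Hy]]; [unfold pdom; congruence|].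
      exists (y :: B). split; [now constructor|]. intros n z' Hn E'.
      destruct (Nat.eq_dec n N) as [->|].
      * exists y. split; [now left|]. replace z' with z by congruence.
        now apply (accel_ge _ _ _ Hpo _ _ _ Hy).
      * apply (covers_app_r [y] B), HB with n; auto. lia.
    + exists B. split; [exact UB|]. intros n z' Hn E'.
      destruct (Nat.eq_dec n N) as [->|]; [congruence|]. apply HB with n; auto. lia.
Qed.

(** Divide [n] by [p]: one acceleration [d] bounds all powers with exponent a multiple of [p], and
    fewer than [p] further applications start from [d]. *)
Lemma ascending_powers_covered (a b : X) (u : list L) (p : nat) :
  U a -> 0 < p -> wrun tr (concat (repeat u p)) a = Some b -> le a b ->
  exists B, Forall U B /\
    forall n z, wrun tr (concat (repeat u n)) a = Some z -> covers B z.
Proof.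
  intros Ua Hp E Hab. destruct (accel_powers a b _ Ua E Hab) as [d [Ud Hd]].
  destruct (small_powers_covered d u p Ud) as [B [UB HB]].
  exists B. split; [exact UB|]. intros n z Ez.
  rewrite (Nat.div_mod_eq n p), repeat_concat_add, repeat_concat_mul, wrun_app in Ez.
  destruct (wrun tr (concat (repeat (concat (repeat u p)) (n / p))) a) as [z1|] eqn:E1;
    [|discriminate].
  destruct (wrun_mono _ _ _ _ Hm _ _ _ _ (Hd _ _ E1) Ez) as [z2 [E2 H2]].
  destruct (HB (n mod p) z2) as [c [Hc Hle]]; auto.
  { apply Nat.mod_upper_bound. lia. }
  exists c. split; auto. pose proof (proj1 (proj2 Hpo)) as Ht. eauto.
Qed.

(* When no power of [u] increases [a], accelerating a power of [u] at [a] just applies it,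
   so all iterates belong to [U], and one of them is below a later one. *)
Lemma powers_covered (a : X) (u : list L) : U a ->
  exists B, Forall U B /\
    forall n z, wrun tr (concat (repeat u n)) a = Some z -> covers B z.
Proof.
  intros Ua.
  destruct (classic (exists N, wrun tr (concat (repeat u N)) a = None)) as [[N EN]|Htotal].
  - destruct (small_powers_covered a u N Ua) as [B [UB HB]]. exists B. split; [exact UB|].
    intros n z Ez. apply HB with n; auto. destruct (le_lt_dec N n) as [Hn|]; auto.
    exfalso. replace n with (N + (n - N)) in Ez by lia.
    now rewrite repeat_concat_add, wrun_app, EN in Ez.
  - assert (Hf : forall n, exists z, wrun tr (concat (repeat u n)) a = Some z).
    { intros n. destruct (wrun tr (concat (repeat u n)) a) as [z|] eqn:E; [eauto|].
      exfalso. eauto. }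
    apply functional_choice in Hf as [f Hf].
    destruct (classic (exists p, 0 < p /\ le a (f p))) as [[p [Hp Hle]]|Hno].
    + now apply (ascending_powers_covered a (f p) u p).
    + assert (Uf : forall n, U (f n)).
      { intros [|n].
        - specialize (Hf 0). simpl in Hf. congruence.
        - destruct (HU a (concat (repeat u (S n))) Ua) as [y [Uy [b [E Hy]]]].
          { unfold pdom. rewrite Hf. discriminate. }
          rewrite Hf in E. injection E as <-. destruct Hy as [[[Hle _] _]|[_ ->]]; auto.
          exfalso. apply Hno. exists (S n). split; [lia|auto]. }
      assert (Hshift : forall i n, i <= n ->
        wrun tr (concat (repeat u (n - i))) (f i) = wrun tr (concat (repeat u n)) a).
      { intros i n Hin. replace n with (i + (n - i)) at 2 by lia.
        now rewrite repeat_concat_add, wrun_app, Hf. }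
      (* From [f i] on, the power [j - i] of [u] ascends; the first [i] iterates are bounded
         separately. *)
      destruct (Hgood f) as [i [j [Hij Hle]]].
      destruct (ascending_powers_covered (f i) (f j) u (j - i)) as [B [UB HB]]; auto.
      { lia. }
      { rewrite Hshift by lia. apply Hf. }
      destruct (small_powers_covered a u i Ua) as [C [UC HC]].
      exists (B ++ C). split; [now apply Forall_app_intro|]. intros n z Ez.
      destruct (le_lt_dec i n) as [Hn|Hn].
      * apply covers_app_l, HB with (n - i). now rewrite Hshift.
      * apply covers_app_r. now apply HC with n.
Qed.

(** The powers of the first word are bounded by finitely many members of [U]; the induction
    hypothesis applies at each of them, and monotonicity carries the rest of the word up to these
    bounds. *)
Lemma starprod_covered (ws : list (list L)) (a : X) : U a ->
  exists B, Forall U B /\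
    forall w z, in_starprod ws w -> wrun tr w a = Some z -> covers B z.
Proof.
  revert a. induction ws as [|u ws IH]; intros a Ua.
  - exists [a]. split; [now repeat constructor|]. intros w z -> E. injection E as <-.
    exists a. split; [now left|apply Hpo].
  - destruct (powers_covered a u Ua) as [C [UC HC]].
    assert (HB : exists B, Forall U B /\ forall c w z, In c C ->
       in_starprod ws w -> wrun tr w c = Some z -> covers B z).
    { clear HC. induction UC as [|c C Uc UC [B [UB HB]]].
      - exists []. split; [constructor|]. intros c w z [].
      - destruct (IH c Uc) as [B' [UB' HB']]. exists (B' ++ B).
        split; [now apply Forall_app_intro|]. intros c' w z [<-|Hc'] Hw E.
        + apply covers_app_l. eauto.
        + apply covers_app_r. eauto. }
    destruct HB as [B [UB HB]]. exists B. split; [exact UB|].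
    intros w z [n [w' [-> Hw']]] E. rewrite wrun_app in E.
    destruct (wrun tr (concat (repeat u n)) a) as [z1|] eqn:E1; [|discriminate].
    destruct (HC n z1 E1) as [c [Hc Hle]].
    destruct (wrun_mono _ _ _ _ Hm _ _ _ _ Hle E) as [z2 [E2 H2]].
    destruct (HB c w' z2 Hc Hw' E2) as [b [Hb Hb']]. exists b. split; auto.
    pose proof (proj1 (proj2 Hpo)) as Ht. eauto.
Qed.

End AccelerationClosed.

(** * Runs of the Clover procedure *)

Lemma finite_words_enum (L : Type) : Finite L -> exists e : nat -> list L, forall w, exists n, e n = w.
Proof.
  intros [l Hl].
  set (wl := fix wl k := match k with
     0 => [[]] | S k' => flat_map (fun a => map (cons a) (wl k')) l end).
  assert (Hwl : forall w, In w (wl (length w))).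
  { induction w as [|a w IH]; simpl; [now left|].
    apply in_flat_map. exists a. split; [apply Hl|now apply in_map]. }
  (* [wl k] lists the words of length [k]; an index out of range yields the empty word by
     default. *)
  exists (fun n => let (k, i) := of_nat n in nth i (wl k) []).
  intros w. destruct (In_nth (wl (length w)) w [] (Hwl w)) as [i [_ Hi]].
  exists (to_nat (length w, i)). now rewrite cancel_of_to.
Qed.

Section Procedure.
Variables (X L : Type) (le : X -> X -> Prop) (tr : L -> X -> option X).

(** The part common to a returning run and to the start of a fair infinite run, so that invariants
    are proved once for both. *)
Definition partial_run (s0 : X) (As : nat -> list X) (ch : nat -> list L * X) (n : nat) : Prop :=
  As 0 = [s0] /\
  forall m, m < n -> clover_step le tr (As m) (fst (ch m)) (snd (ch m)) (As (S m)).

Lemma fair_run_partial (s0 : X) (As : nat -> list X) (ch : nat -> list L * X) (n : nat) :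
  fair_infinite_run le tr s0 As ch -> partial_run s0 As ch n.
Proof. intros [H0 [Hs _]]. split; auto. Qed.

Lemma run_incl (s0 : X) (As : nat -> list X) (ch : nat -> list L * X) (m n : nat) :
  partial_run s0 As ch n -> m <= n -> incl (As m) (As n).
Proof.
  intros [H0 Hs] Hmn. induction Hmn as [|n Hmn IH]; [apply incl_refl|].
  destruct (Hs n) as [_ [_ [_ [y [_ ->]]]]]; [lia|].
  apply incl_appl, IH. intros k Hk. apply Hs. lia.
Qed.

Hypothesis Hm : forall a, pmono le (tr a).

(* Step [n] serves the request coded by the second Cantor component of [n], if that request is
   enabled; every request is thus served at unboundedly many steps. *)
Lemma clover_terminates_returns (s0 : X) :
  Finite L -> dcpo le -> clover_terminates le tr s0 -> exists B, clover_returns le tr s0 B.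
Proof.
  intros HL Hd Hterm. pose proof (proj1 Hd) as Hpo.
  destruct (finite_words_enum L HL) as [e He].
  (* The loop condition is a premise, so the sequence can be prolonged after the loop has exited and
     the two outcomes are separated afterwards. *)
  set (R := fun n A A' => loop_cond le tr A -> exists c,
     clover_step le tr A (fst c) (snd c) A' /\
     forall b, nth_error A (snd (of_nat (snd (of_nat n)))) = Some b ->
       pdom (wrun tr (e (fst (of_nat (snd (of_nat n)))))) b ->
       c = (e (fst (of_nat (snd (of_nat n)))), b)).
  destruct (dependent_choice (fun _ => True) R [s0] I) as [As [H0 HAs]].
  { intros n A _. unfold R. set (g := e _). set (i := snd (of_nat (snd _))).
    destruct (classic (loop_cond le tr A)) as [Hloop|Hloop]; [|exists A; tauto].
    destruct (classic (exists b, nth_error A i = Some b /\ pdom (wrun tr g) b)) as [[b [Eb Hb]]|Hno].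
    - destruct (accel_exists X le (wrun tr g) Hpo (wrun_pmono X L le tr Hm g) b Hd Hb) as [y Hy].
      exists (A ++ [y]). split; [exact I|]. intros _. exists (g, b). split.
      + split; [exact Hloop|]. split; [now apply nth_error_In in Eb|]. split; [exact Hb|eauto].
      + intros b' Eb' _. congruence.
    (* When the request cannot be served, some single letter is still enabled: otherwise [post] is
       empty and the loop would have exited. *)
    - assert (Hpost : exists a s, In s A /\ pdom (tr a) s).
      { apply NNPP. intros Hn. apply Hloop. intros x [y [[a [s [Hs E]]] _]].
        exfalso. apply Hn. exists a, s. split; [exact Hs|]. unfold pdom; congruence. }
      destruct Hpost as [a [s [Hs Ha]]].
      assert (Ha' : pdom (wrun tr [a]) s) by (unfold pdom in *; simpl; now destruct (tr a s)).
      destruct (accel_exists X le _ Hpo (wrun_pmono X L le tr Hm [a]) s Hd Ha') as [y Hy].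
      exists (A ++ [y]). split; [exact I|]. intros _. exists ([a], s). split.
      + split; [exact Hloop|]. split; [exact Hs|]. split; [exact Ha'|eauto].
      + intros b Eb Hb. exfalso. eauto. }
  assert (Hch : forall n, exists c, loop_cond le tr (As n) ->
     clover_step le tr (As n) (fst c) (snd c) (As (S n)) /\
     forall b, nth_error (As n) (snd (of_nat (snd (of_nat n)))) = Some b ->
       pdom (wrun tr (e (fst (of_nat (snd (of_nat n)))))) b ->
       c = (e (fst (of_nat (snd (of_nat n)))), b)).
  { intros n. destruct (HAs n) as [_ HR]. unfold R in HR.
    destruct (classic (loop_cond le tr (As n))) as [Hl|Hl].
    - destruct (HR Hl) as [c Hc]. exists c. auto.
    - exists ([], s0). tauto. }
  apply functional_choice in Hch as [ch Hch].
  destruct (classic (exists n, ~ loop_cond le tr (As n))) as [Hstop|Hnever].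
  - assert (Hleast : exists n, ~ loop_cond le tr (As n) /\ forall m, m < n -> loop_cond le tr (As m)).
    { destruct Hstop as [n Hn]. revert Hn. induction n as [n IH] using lt_wf_ind. intros Hn.
      destruct (classic (exists m, m < n /\ ~ loop_cond le tr (As m))) as [[m [Hmn Hm']]|Hno].
      - exact (IH m Hmn Hm').
      - exists n. split; [exact Hn|]. intros m Hmn. apply NNPP. intros Hm'. eauto. }
    destruct Hleast as [n [Hn Hbefore]].
    exists (maxset le (inlist (As n))), n, As, ch. split; [exact H0|].
    split; [intros m Hmn; now apply Hch, Hbefore|]. split; [exact Hn|]. intros x; tauto.
  - exfalso. apply Hterm. exists As, ch.
    assert (Hloop : forall n, loop_cond le tr (As n)).
    { intros n. apply NNPP. intros Hn. eauto. }
    split; [exact H0|]. split; [intros n; now apply Hch|].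
    intros n g a Ha Hga. apply In_nth_error in Ha as [i Hi]. destruct (He g) as [k <-].
    (* The first component makes this step at least [n]; the second codes the word [e k] and the
       position [i]. *)
    exists (to_nat (n, to_nat (k, i))).
    pose proof (to_nat_non_decreasing n (to_nat (k, i))) as Hle. split; [lia|].
    destruct (Hch (to_nat (n, to_nat (k, i))) (Hloop _)) as [_ Hserve].
    rewrite cancel_of_to in Hserve. cbn [fst snd] in Hserve.
    rewrite cancel_of_to in Hserve. cbn [fst snd] in Hserve.
    apply Hserve; [|exact Hga]. set (m := to_nat (n, to_nat (k, i))) in *.
    assert (Hnm : n <= m) by lia. clearbody m.
    (* New states are appended at the end, so position [i] keeps its content. *)
    clear - Hi Hnm Hch Hloop. induction Hnm as [|m Hnm IH]; [exact Hi|].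
    destruct (Hch m (Hloop m)) as [[_ [_ [_ [y [_ ->]]]]] _].
    rewrite nth_error_app1; [exact IH|]. apply nth_error_Some. congruence.
Qed.

End Procedure.

Arguments partial_run {X L}.

(** Keeping [a] outside the list lets the induction move up to the head whenever the head is above
    [a]. *)
Lemma below_maximal {X : Type} (le : X -> X -> Prop) (l : list X) : partial_order le ->
  forall a, exists b, (b = a \/ In b l) /\ le a b /\ forall c, In c l -> le b c -> c = b.
Proof.
  intros [Hr [Ht Ha]]. induction l as [|x l IH]; intros a.
  - exists a. split; [now left|]. split; [apply Hr|]. intros c [].
  - destruct (classic (le a x)) as [Hax|Hax].
    + destruct (IH x) as [b [Hb [Hxb Hmax]]]. exists b. split; [|split].
      * right. destruct Hb as [->|Hb]; [now left|now right].
      * eauto.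
      * intros c [<-|Hc] Hbc; auto.
    + destruct (IH a) as [b [Hb [Hab Hmax]]]. exists b. split; [|split; [exact Hab|]].
      * destruct Hb as [->|Hb]; [now left|right; now right].
      * intros c [<-|Hc] Hbc; auto. exfalso. eauto.
Qed.

(** * The Clover procedure on the completion *)

Section CompletionProcedure.
Variables (X L : Type) (le : X -> X -> Prop) (tr : L -> X -> option X).
Hypothesis Hpo : partial_order le.
Hypothesis Hm : forall a, pmono le (tr a).
Variable x0 : X.
Let s0 := eta Hpo x0.
Let htr := hat_tr Hpo Hm.

(** If [C] escapes every ideal of the list, directedness merges the escaping points into one that
    avoids them all. *)
Lemma ideal_in_finite_union (C : Idl le) (A : list (Idl le)) :
  (forall x, proj1_sig C x -> exists D, In D A /\ proj1_sig D x) ->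
  exists D, In D A /\ idl_le le C D.
Proof.
  intros HC. apply NNPP. intros Hno.
  assert (Hx : exists x, proj1_sig C x /\ forall D, In D A -> ~ proj1_sig D x).
  { clear HC. destruct (proj2_sig C) as [Hne [_ Hdir]].
    induction A as [|D A IH].
    - destruct Hne as [x Cx]. exists x. split; [exact Cx|]. intros D [].
    - destruct IH as [x [Cx Hx]].
      { intros [E [HE HCE]]. apply Hno. exists E. split; [now right|exact HCE]. }
      assert (Hy : exists y, proj1_sig C y /\ ~ proj1_sig D y).
      { apply NNPP. intros Hn. apply Hno. exists D. split; [now left|].
        intros y Cy. apply NNPP. intros Dy. eauto. }
      destruct Hy as [y [Cy Hy]]. destruct (Hdir x y Cx Cy) as [z [Cz [Hxz Hyz]]].
      exists z. split; [exact Cz|]. intros E HE Ez.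
      destruct (proj2_sig E) as [_ [Hdown _]].
      destruct HE as [<-|HE]; [apply Hy|apply (Hx E HE)]; eauto. }
  destruct Hx as [x [Cx Hx]]. destruct (HC x Cx) as [D [HD Dx]]. now apply (Hx D).
Qed.

(** The lub is a union, so each point of an accelerated ideal is already reached by a finite power
    of [g]. *)
Lemma accel_below (g : list L) (C D : Idl le) (x : X) :
  is_accel (idl_le le) (wrun htr g) C D -> proj1_sig D x ->
  exists n y z, proj1_sig C y /\ wrun tr (concat (repeat g n)) y = Some z /\ le x z.
Proof.
  intros [E [EC [[[Hle _] Hlub]|[_ ->]]]] Dx.
  - rewrite idl_lub_iff in Hlub.
    + apply Hlub in Dx as [I [[n EI] Ix]]. rewrite wrun_iter in EI.
      apply (hat_wrun X L le tr Hpo Hm _ _ _ EI) in Ix. exists n. exact Ix.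
    + apply iter_directed with E; auto; [apply idl_le_po|].
      apply wrun_pmono, hat_tr_pmono.
  - apply (hat_wrun X L le tr Hpo Hm _ _ _ EC) in Dx. exists 1. simpl. now rewrite app_nil_r.
Qed.

(** Each step adds its chosen word as a last factor: new points are reached by a power of it from
    points covered before. *)
Lemma run_flatly_covered (As : nat -> list (Idl le)) (ch : nat -> list L * Idl le) (n : nat) :
  partial_run (idl_le le) htr s0 As ch n ->
  exists ws, forall C, In C (As n) ->
    subset (proj1_sig C) (covered_along le tr (in_starprod ws) x0).
Proof.
  intros [H0 Hs]. pose proof (proj1 (proj2 Hpo)) as Ht. induction n as [|n IH].
  - exists []. rewrite H0. intros C [<-|[]] x Hx. exists [], x0. repeat split. exact Hx.
  - destruct IH as [ws Hws]; [intros m Hmn; apply Hs; lia|].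
    destruct (Hs n) as [_ [Ha [_ [D [HD ->]]]]]; [lia|].
    set (g := fst (ch n)) in *. exists (ws ++ [g]). intros C HC x Cx.
    apply in_app_or in HC as [HC|[<-|[]]].
    + destruct (Hws C HC x Cx) as [w [y [Hw Hy]]]. exists w, y. split; [|exact Hy].
      rewrite <- (app_nil_r w). apply starprod_app; [exact Hw|apply starprod_nil].
    + destruct (accel_below _ _ _ x HD Cx) as [k [y [z [Cy [Ez Hxz]]]]].
      destruct (Hws _ Ha y Cy) as [w [y' [Hw [Ey Hyy']]]].
      destruct (wrun_mono X L le tr Hm _ _ _ _ Hyy' Ez) as [z' [Ez' Hzz']].
      exists (w ++ concat (repeat g k)), z'. split; [|split].
      * apply starprod_app; [exact Hw|]. exists k, []. now rewrite app_nil_r.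
      * now rewrite wrun_app, Ey.
      * eauto.
Qed.

Lemma run_below_cover (As : nat -> list (Idl le)) (ch : nat -> list L * Idl le) (n : nat)
  (C : Idl le) :
  partial_run (idl_le le) htr s0 As ch n -> In C (As n) ->
  subset (proj1_sig C) (cover le tr x0).
Proof.
  intros Hrun HC x Cx. destruct (run_flatly_covered As ch n Hrun) as [ws Hws].
  destruct (Hws C HC x Cx) as [w [y [_ Hy]]]. apply cover_iff; eauto.
Qed.

Lemma cover_step (a : L) (x y : X) : cover le tr x0 x -> tr a x = Some y -> cover le tr x0 y.
Proof.
  rewrite !cover_iff; auto. intros [w [z [Ez Hxz]]] Ey.
  destruct (Hm a) as [Hdom Hmon].
  assert (Hd : pdom (tr a) z) by (apply (Hdom x z Hxz); unfold pdom; congruence).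
  unfold pdom in Hd. destruct (tr a z) as [z'|] eqn:Ez'; [|congruence].
  exists (w ++ [a]), z'. rewrite wrun_app, Ez. simpl. rewrite Ez'. eauto.
Qed.

Lemma flatly_covered_terminates :
  omega2_wqo le -> flatly_covered le tr x0 -> clover_terminates (idl_le le) htr s0.
Proof.
  intros Hw [ws Hws] [As [ch Hfair]]. pose proof Hfair as [H0 [Hs Hf]].
  pose proof (fun n => fair_run_partial _ L (idl_le le) htr s0 As ch n Hfair) as Hrun.
  set (U := fun C => exists n, In C (As n)).
  destruct (starprod_covered _ L (idl_le le) htr U (idl_le_po le)
      (hat_tr_pmono X L le tr Hpo Hm) (idl_good le Hw)) with (ws := ws) (a := s0) as [B [UB HB]].
  { intros C g [n Cn] Hg. destruct (Hf n g C Cn Hg) as [m [_ Em]].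
    destruct (Hs m) as [_ [_ [_ [D [HD ED]]]]]. rewrite Em in HD. exists D. split; [|exact HD].
    exists (S m). rewrite ED. apply in_or_app. right. now left. }
  { exists 0. rewrite H0. now left. }
  (* The collected lists grow, so the finitely many bounds are all present at one stage, and the
     loop must exit there. *)
  assert (HBn : exists n, incl B (As n)).
  { clear HB. induction UB as [|C B [n Cn] UB [m Hm']].
    - exists 0. intros C [].
    - exists (n + m). intros D [<-|HD].
      + apply (run_incl _ L (idl_le le) htr s0 As ch n (n + m)); auto. lia.
      + apply (run_incl _ L (idl_le le) htr s0 As ch m (n + m)); auto. lia. }
  destruct HBn as [n Hn]. destruct (Hs n) as [Hloop _]. apply Hloop.
  intros C [P [[a [D [HD EP]]] HCP]].
  destruct (ideal_in_finite_union C B) as [J [HJ HCJ]];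
    [|exists J; split; [now apply Hn|exact HCJ]].
  (* A point of a successor ideal belongs to the cover of [x0], hence is reached along a word of
     [ws] and lies in a member of [B]. *)
  intros x Cx. apply HCP in Cx. apply (hat_some X le Hpo _ _ _ _ EP) in Cx.
  destruct Cx as [y [fy [Dy [Ey Hx]]]].
  apply (run_below_cover As ch n D (Hrun n) HD) in Dy.
  apply (cover_step a y fy Dy) in Ey. apply Hws in Ey as [w [z [Hww [Ez Hz]]]].
  destruct (wrun_eta X L le tr Hpo Hm x0 w x z Ez) as [E [EE Ex]].
  { pose proof (proj1 (proj2 Hpo)) as Ht. eauto. }
  destruct (HB w E Hww EE) as [J [HJ HEJ]]. exists J. split; [exact HJ|exact (HEJ x Ex)].
Qed.

Section Returned.
Variables (As : nat -> list (Idl le)) (ch : nat -> list L * Idl le) (n : nat).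
Hypothesis Hrun : partial_run (idl_le le) htr s0 As ch n.
Hypothesis Hstop : ~ loop_cond (idl_le le) htr (As n).

(** The exit condition and monotonicity make the downward closure of the final list invariant under
    every transition. *)
Lemma stopped_closed (w : list L) (C D : Idl le) :
  dc (idl_le le) (inlist (As n)) C -> wrun htr w C = Some D ->
  dc (idl_le le) (inlist (As n)) D.
Proof.
  revert C. induction w as [|a w IH]; simpl; intros C HC E; [congruence|].
  destruct (htr a C) as [C'|] eqn:EC; [|discriminate]. apply (IH C'); auto.
  destruct HC as [F [HF HCF]]. apply NNPP in Hstop. apply Hstop.
  destruct (hat_tr_pmono X L le tr Hpo Hm a) as [Hdom Hmon].
  assert (Hd : pdom (htr a) F) by (apply (Hdom C F HCF); unfold pdom, htr in *; congruence).
  unfold pdom in Hd. destruct (htr a F) as [F'|] eqn:EF; [|congruence].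
  exists F'. split; [now exists a, F|]. now apply (Hmon C F).
Qed.

Lemma stopped_covers (x : X) :
  cover le tr x0 x -> exists C, In C (As n) /\ proj1_sig C x.
Proof.
  intros Hx. apply cover_iff in Hx as [w [z [Ez Hxz]]]; auto.
  destruct (wrun_eta X L le tr Hpo Hm x0 w x z Ez Hxz) as [D [ED Dx]].
  destruct (stopped_closed w s0 D) as [C [HC HDC]]; [|exact ED|eauto].
  exists s0. split; [|apply idl_le_po].
  apply (run_incl _ L (idl_le le) htr s0 As ch 0 n Hrun); [lia|].
  rewrite (proj1 Hrun). now left.
Qed.

Lemma stopped_flatly_covered : flatly_covered le tr x0.
Proof.
  destruct (run_flatly_covered As ch n Hrun) as [ws Hws]. exists ws. intros x Hx.
  destruct (stopped_covers x Hx) as [C [HC Cx]]. now apply (Hws C).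
Qed.

(** Points of such a lub lie in the cover of [x0], hence in the finite union of the collected
    ideals, hence all in one of them. Conversely an ideal below a collected one is the lub of
    principal ideals that belong to the cover. *)
Lemma stopped_lubs (C : Idl le) :
  lubs (idl_le le) (cover (idl_le le) htr s0) C <-> exists D, In D (As n) /\ idl_le le C D.
Proof.
  split.
  - intros [E [HE [HEc Hl]]]. apply ideal_in_finite_union. intros x Cx.
    rewrite idl_lub_iff in Hl by exact HE. apply Hl in Cx as [D [ED Dx]].
    apply stopped_covers. apply (hat_cover_below X L le tr Hpo Hm x0 D); auto.
  - intros [D [HD HCD]]. destruct (eta_approx X le Hpo C) as [HE Hl].
    eexists. split; [exact HE|]. split; [|exact Hl].
    intros E [x [Cx ->]]. apply cover_eta. apply (run_below_cover As ch n D Hrun HD). auto.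
Qed.

(** The lubs form the downward closure of the final list, which has the same maximal elements as the
    list. *)
Lemma stopped_maximal (C : Idl le) :
  maxset (idl_le le) (inlist (As n)) C <-> clover (idl_le le) htr s0 C.
Proof.
  destruct (idl_le_po le) as [Hr [Ht Ha]]. split.
  - intros [HC Hmax]. split.
    + apply stopped_lubs. exists C. split; auto.
    + intros D HD HCD. apply stopped_lubs in HD as [E [HE HDE]].
      rewrite (Hmax E HE) in HDE; eauto.
  - intros [HC Hmax]. pose proof HC as HC'. apply stopped_lubs in HC' as [D [HD HCD]].
    assert (HDl : lubs (idl_le le) (cover (idl_le le) htr s0) D)
      by (apply stopped_lubs; exists D; auto).
    rewrite (Hmax D HDl HCD) in HD. split; [exact HD|].
    intros E HE HCE. apply Hmax; auto. apply stopped_lubs. exists E; auto.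
Qed.

Lemma stopped_cover (x : X) :
  cover le tr x0 x <->
  exists C, maxset (idl_le le) (inlist (As n)) C /\ idl_le le (eta Hpo x) C.
Proof.
  split.
  - intros Hx. destruct (stopped_covers x Hx) as [C [HC Cx]].
    destruct (below_maximal (idl_le le) (As n) (idl_le_po le) C) as [D [HD [HCD Hmax]]].
    exists D. split.
    + split; [|exact Hmax]. now destruct HD as [->|HD].
    + apply eta_le. auto.
  - intros [C [[HC _] HxC]]. apply eta_le in HxC. exact (run_below_cover As ch n C Hrun HC x HxC).
Qed.

End Returned.

End CompletionProcedure.

Theorem theorem5p26 (X L : Type) (le : X -> X -> Prop) (tr : L -> X -> option X)
  (Hw : omega2_wqo le) (HL : Finite L) (Hm : forall a, pmono le (tr a))
  (Heff : infty_effective (idl_le le) (hat_tr (omega2_po Hw) Hm))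
  (x0 : X) :
  (cover_flattable le tr x0 <-> weakly_cover_flattable le tr x0) /\
  (cover_flattable le tr x0 <-> strongly_cover_flattable le tr x0) /\
  (cover_flattable le tr x0 <->
     clover_flattable (idl_le le) (hat_tr (omega2_po Hw) Hm) (eta (omega2_po Hw) x0)) /\
  (cover_flattable le tr x0 <->
     weakly_clover_flattable (idl_le le) (hat_tr (omega2_po Hw) Hm) (eta (omega2_po Hw) x0)) /\
  (cover_flattable le tr x0 <->
     strongly_clover_flattable (idl_le le) (hat_tr (omega2_po Hw) Hm) (eta (omega2_po Hw) x0)) /\
  (cover_flattable le tr x0 <->
     clover_terminates (idl_le le) (hat_tr (omega2_po Hw) Hm) (eta (omega2_po Hw) x0)) /\
  (clover_terminates (idl_le le) (hat_tr (omega2_po Hw) Hm) (eta (omega2_po Hw) x0) ->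
     (exists B, clover_returns (idl_le le) (hat_tr (omega2_po Hw) Hm) (eta (omega2_po Hw) x0) B) /\
     forall B, clover_returns (idl_le le) (hat_tr (omega2_po Hw) Hm) (eta (omega2_po Hw) x0) B ->
       seteq B (clover (idl_le le) (hat_tr (omega2_po Hw) Hm) (eta (omega2_po Hw) x0)) /\
       seteq (cover le tr x0)
             (fun x => exists C, B C /\ idl_le le (eta (omega2_po Hw) x) C)).
Proof.
  clear Heff. set (Hpo := omega2_po Hw).
  pose proof (hat_tr_pmono X L le tr Hpo Hm) as Hhm.
  pose proof (weakly_cover_flatly_covered X L le tr x0 Hpo Hm) as Hweak.
  pose proof (flatly_covered_strongly X L le tr x0 Hpo Hm) as Hstrong.
  pose proof (strongly_cover_flattable_cover X L le tr x0 Hpo HL Hm) as Hcov.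
  pose proof (cover_flattable_weakly X L le tr x0 Hpo) as Hcovweak.
  pose proof (flatly_covered_strongly_clover X L le tr Hpo Hm x0) as Hstrong'.
  pose proof (strongly_clover_flattable_clover _ L (idl_le le) (hat_tr Hpo Hm) (eta Hpo x0)
    (hat_complete_ts X L le tr Hpo Hm Hw HL)) as Hcov'.
  pose proof (clover_flattable_weakly _ L (idl_le le) (hat_tr Hpo Hm) (eta Hpo x0) (idl_le_po le))
    as Hcovweak'.
  pose proof (weakly_clover_flatly_covered X L le tr Hpo Hm x0) as Hweak'.
  pose proof (flatly_covered_terminates X L le tr Hpo Hm x0 Hw) as Hterm.
  pose proof (clover_terminates_returns _ L (idl_le le) (hat_tr Hpo Hm) Hhm (eta Hpo x0) HL
    (idl_dcpo X le)) as Hret.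
  assert (Hret' : clover_terminates (idl_le le) (hat_tr Hpo Hm) (eta Hpo x0) ->
     flatly_covered le tr x0).
  { intros Ht. destruct (Hret Ht) as [B [n [As [ch [H0 [Hs [Hstop _]]]]]]].
    exact (stopped_flatly_covered X L le tr Hpo Hm x0 As ch n (conj H0 Hs) Hstop). }
  (* All implications now pass through [flatly_covered], so the equivalences are propositional. *)
  do 6 (split; [tauto|]). intros Ht. split; [exact (Hret Ht)|].
  intros B [n [As [ch [H0 [Hs [Hstop HB]]]]]]. split.
  - intros C. rewrite (HB C).
    exact (stopped_maximal X L le tr Hpo Hm x0 As ch n (conj H0 Hs) Hstop C).
  - intros x. rewrite (stopped_cover X L le tr Hpo Hm x0 As ch n (conj H0 Hs) Hstop x).
    split; intros [C [HC Hx]]; exists C; split; auto; now apply HB.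
Qed.
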